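(* Let $C$ be a fusion category over $\mathbb C$ with representative simple objects $X_i$, $i\in I$. Suppose that a choice of roots $d_i^2=d_{\{i,i^*\}}$, $d_i=d_{i^*}$, of the paired dimensions has been made, with resulting involution operators $T^i_{jk}:\mathrm{Hom}(X_i,X_j\otimes X_k)\to\mathrm{Hom}(X_i,X_j\otimes X_k)$. Then: 1. Unless $T^i_{jk}=\pm\mathrm{id}$ for all $i,j,k$, the fusion category $C$ cannot carry an even-handed structure. 2. Suppose that $T^i_{jk}=\epsilon^i_{jk}\,\mathrm{id}$ for all $i,j,k$, where $\epsilon^i_{jk}=\pm1$. Then an even-handed structure on $C$ is the same thing as an $\epsilon$-twisted monoidal natural transformation of the identity on $C$; that is, there is a canonical bijection of sets $$\mathrm{EvenHanded}(C)\cong\mathrm{Aut}^\epsilon_\otimes(\mathrm{id}_C).$$ 3. Furthermore (in the situation of part 2), the even-handed structure can be made spherical (i.e. $C$ admits a spherical even-handed structure) if and only if $[\epsilon]=0$ in $H_{\mathrm{piv}}([C],\mathbb Z/2)$.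
   Context: **Fusion category.** A semisimple $\mathbb C$-linear rigid monoidal category with finitely many isomorphism classes of simple objects (representatives $X_i$, $i\in I$) and simple unit object $1$. A right dual of $V$ is $(V^*,\eta,\epsilon)$ with $\eta:1\to V^*\otimes V$, $\epsilon:V\otimes V^*\to1$ satisfying the snake equations. In a fusion category right duals are also left duals. $i^*$ denotes the index of the dual of $X_i$; $[C]$ is the Grothendieck (fusion) ring with basis $[X_i]$ and $[X_j][X_k]=\sum_iN^i_{jk}[X_i]$. Associators and unit isomorphisms are suppressed. **Even-handed structure.** Let $\mathrm{Adj}(V\dashv V^* )$ be the set of pairs $(\eta,\epsilon)$ exhibiting $V^*$ as a right dual of $V$; thus an element $(n,e)$ of $\mathrm{Adj}(V^*\dashv V)$ has $n:1\to V\otimes V^*$, $e:V^*\otimes V\to1$. An even-handed structure assigns to each pair $(V,V^* )$ of an object and a dual a map $\Psi:\mathrm{Adj}(V\dashv V^* )\to\mathrm{Adj}(V^*\dashv V)$ such that: (i) $\Psi^2=\mathrm{id}$; (ii) $\Psi$ sends the (nested) tensor product duality for $V\otimes W$, with dual $W^*\otimes V^*$, built from $(\eta_V,\epsilon_V)$ and $(\eta_W,\epsilon_W)$ to the one built from $\Psi(\eta_V,\epsilon_V)$ and $\Psi(\eta_W,\epsilon_W)$, and is the identity on the trivial self-duality of $1$; (iii) for every $\theta:V\to W$ and all right duals, the right dagger $\theta^\dagger=(\mathrm{id}_{V^*}\otimes\epsilon_W)(\mathrm{id}\otimes\theta\otimes\mathrm{id})(\eta_V\otimes\mathrm{id}_{W^*}):W^*\to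 V^*$ equals the left dagger $(e_W\otimes\mathrm{id}_{V^*})(\mathrm{id}\otimes\theta\otimes\mathrm{id})(\mathrm{id}_{W^*}\otimes n_V)$, where $(n_V,e_V)=\Psi(\eta_V,\epsilon_V)$ and $(n_W,e_W)=\Psi(\eta_W,\epsilon_W)$. $\mathrm{EvenHanded}(C)$ is the set of these. $\Psi$ is spherical if for every endomorphism $f:V\to V$ the two traces $e\circ(\mathrm{id}_{V^*}\otimes f)\circ\eta$ and $\epsilon\circ(f\otimes\mathrm{id}_{V^*})\circ n$ in $\mathrm{End}(1)=\mathbb C$ agree, where $(V^*,\eta,\epsilon)$ is any right dual and $(n,e)=\Psi(\eta,\epsilon)$. **Paired dimensions and partner convention.** For simple $X_i$, choose $(\eta,\epsilon)\in\mathrm{Adj}(X_i\dashv X_i^* )$ and $(n,e)\in\mathrm{Adj}(X_i^*\dashv X_i)$; the paired dimension is $d_{\{i,i^*\}}=(e\circ\eta)(\epsilon\circ n)\in\mathbb C^\times$, independent of choices. A root choice is a family $d_i$ with $d_i^2=d_{\{i,i^*\}}$ and $d_i=d_{i^*}$. Given a root choice, each $(\eta_i,\epsilon_i)\in\mathrm{Adj}(X_i\dashv X_i^* )$ has a unique partner $(n_i,e_i)\in\mathrm{Adj}(X_i^*\dashv X_i)$ with $e_i\circ\eta_i=d_i$ (equivalently $\epsilon_i\circ n_i=d_i$). **Involution operators.** For $v:X_i\to X_j\otimes X_k$, with duals $(\eta_i,\epsilon_i)$ etc. and their partners, let $v^\dagger=(\mathrm{id}_{X_i^*}\otimes\epsilon_{jk})(\mathrm{id}\otimes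 v\otimes\mathrm{id})(\eta_i\otimes\mathrm{id}):X_k^*\otimes X_j^*\to X_i^*$, where $\epsilon_{jk}:X_j\otimes X_k\otimes X_k^*\otimes X_j^*\to1$ is the nested counit made from $\epsilon_j,\epsilon_k$. Then $T^i_{jk}(v)=(\mathrm{id}_{X_j\otimes X_k}\otimes e_i)(\mathrm{id}\otimes v^\dagger\otimes\mathrm{id}_{X_i})(n_{jk}\otimes\mathrm{id}_{X_i})$, where $n_{jk}:1\to X_j\otimes X_k\otimes X_k^*\otimes X_j^*$ is the nested unit made from the partners $n_j,n_k$. (This is a full rotation of $v$; it is independent of the choices of $(\eta,\epsilon)$, and it is known that $(T^i_{jk})^2=\mathrm{id}$.) **Twisted transformations.** $\mathrm{Aut}^\epsilon_\otimes(\mathrm{id}_C)$ is the set of families of nonzero numbers $(t_i)_{i\in I}$ with $t_jt_k=\epsilon^i_{jk}t_i$ whenever $X_i$ appears in $X_j\otimes X_k$. **Pivotal cohomology.** A collection of pivotal symbols on $[C]$ is a family of signs $\epsilon^i_{jk}=\pm1$ (indexed by the triples with $N^i_{jk}\neq0$) with $\epsilon^i_{jk}=\epsilon^{k^*}_{i^*j}$, $\epsilon^i_{jk}=\epsilon^{i^*}_{k^*j^*}$ and $\epsilon^0_{ii^*}=1$ (index $0$ denoting the unit object). Two are equivalent if there is $f:I\to\{1,-1\}$ with $f_0=1$, $f_i=f_{i^*}$ and $\epsilon'^i_{jk}=f_if_jf_k\epsilon^i_{jk}$. $H_{\mathrm{piv}}([C],\mathbb Z/2)$ is the abelian group (under multiplication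 of signs) of equivalence classes; $[\epsilon]=0$ means that $\epsilon$ is equivalent to the constant family $1$.
   Formalization: Part 3 is stated only for root choices with d_0 = 1 at the unit object; the stated conventions also allow d_0 = -1, but then ε^0_{ii*} = -1 for all i, so ε is not a collection of pivotal symbols and [ε] is undefined. *)

(* Defs.v *)
From HB Require Import structures.
From mathcomp Require Import all_boot all_order all_algebra.
From mathcomp Require Import boolp reals complex.
Set Implicit Arguments. Unset Strict Implicit. Unset Printing Implicit Defensive.
Import GRing.Theory.
Local Open Scope ring_scope.

Declare Scope cat_scope.
Delimit Scope cat_scope with cat.
Local Open Scope cat_scope.

Reserved Notation "V ~> W" (at level 70, no associativity).
Reserved Notation "g ∘ f" (at level 40, left associativity).
Reserved Notation "V ⊗ W" (at level 39, left associativity).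
Reserved Notation "f ⊠ g" (at level 39, left associativity).

Record linCat (K : fieldType) := LinCat {
  obj :> Type;
  hom : obj -> obj -> vectType K;
  idm : forall V, hom V V;
  comp : forall U V W, hom V W -> hom U V -> hom U W;
  compA : forall U V W Z (h : hom W Z) (g : hom V W) (f : hom U V),
    comp h (comp g f) = comp (comp h g) f;
  comp1m : forall U V (f : hom U V), comp (idm V) f = f;
  compm1 : forall U V (f : hom U V), comp f (idm U) = f;
  comp_linear_r : forall U V W (g : hom V W), linear (@comp U V W g);
  comp_linear_l : forall U V W (f : hom U V), linear ((@comp U V W)^~ f)
}.
Arguments idm {K C} V : rename.
Notation "V ~> W" := (hom V W) : cat_scope.
Notation "g ∘ f" := (comp g f) : cat_scope.

Record monCat (K : fieldType) := MonCat {
  lcat :> linCat K;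
  tobj : lcat -> lcat -> lcat;
  thom : forall V V' W W' : lcat,
    V ~> V' -> W ~> W' -> tobj V W ~> tobj V' W';
  one : lcat;
  assoc : forall U V W, tobj (tobj U V) W ~> tobj U (tobj V W);
  assocV : forall U V W, tobj U (tobj V W) ~> tobj (tobj U V) W;
  lunit : forall V, tobj one V ~> V;
  lunitV : forall V, V ~> tobj one V;
  runit : forall V, tobj V one ~> V;
  runitV : forall V, V ~> tobj V one;
  thom_linear_r : forall V V' W W' (f : V ~> V'), linear (@thom V V' W W' f);
  thom_linear_l : forall V V' W W' (g : W ~> W'),
    linear ((@thom V V' W W')^~ g);
  thom1 : forall V W, thom (idm V) (idm W) = idm (tobj V W);
  thomM : forall U V W U' V' W' (g : V ~> W) (f : U ~> V)
      (g' : V' ~> W') (f' : U' ~> V'),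
    thom (g ∘ f) (g' ∘ f') = thom g g' ∘ thom f f';
  assocK : forall U V W, assocV U V W ∘ assoc U V W = idm _;
  assocVK : forall U V W, assoc U V W ∘ assocV U V W = idm _;
  lunitK : forall V, lunitV V ∘ lunit V = idm _;
  lunitVK : forall V, lunit V ∘ lunitV V = idm _;
  runitK : forall V, runitV V ∘ runit V = idm _;
  runitVK : forall V, runit V ∘ runitV V = idm _;
  assoc_nat : forall U V W U' V' W' (f : U ~> U') (g : V ~> V') (h : W ~> W'),
    assoc U' V' W' ∘ thom (thom f g) h = thom f (thom g h) ∘ assoc U V W;
  lunit_nat : forall V W (f : V ~> W),
    lunit W ∘ thom (idm one) f = f ∘ lunit V;
  runit_nat : forall V W (f : V ~> W),
    runit W ∘ thom f (idm one) = f ∘ runit V;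
  pentagon : forall U V W Z,
    assoc U V (tobj W Z) ∘ assoc (tobj U V) W Z =
    thom (idm U) (assoc V W Z) ∘ assoc U (tobj V W) Z
      ∘ thom (assoc U V W) (idm Z);
  triangle : forall V W,
    thom (idm V) (lunit W) ∘ assoc V one W = thom (runit V) (idm W)
}.
Arguments one {K C} : rename.
Notation "V ⊗ W" := (tobj V W) : cat_scope.
Notation "f ⊠ g" := (thom f g) : cat_scope.

Section Duality.
Variables (K : fieldType) (C : monCat K).
Implicit Types (U V W Z : C).

(* Duality data with the associators and unitors written out. *)
Definition snake1 V V' (h : one ~> V' ⊗ V) (e : V ⊗ V' ~> one) : V ~> V :=
  lunit V ∘ (e ⊠ idm V) ∘ assocV V V' V ∘ (idm V ⊠ h) ∘ runitV V.

Definition snake2 V V' (h : one ~> V' ⊗ V) (e : V ⊗ V' ~> one) : V' ~> V' :=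
  runit V' ∘ (idm V' ⊠ e) ∘ assoc V' V V' ∘ (h ⊠ idm V') ∘ lunitV V'.

(* [adj V V'] is Adj(V -| V'): the pairs exhibiting V' as a right dual of V. *)
Record adj V V' := Adj {
  coev : one ~> V' ⊗ V;
  ev : V ⊗ V' ~> one;
  adj_snake1 : snake1 coev ev = idm V;
  adj_snake2 : snake2 coev ev = idm V'
}.

Definition rdagger V V' W W' (a : adj V V') (b : adj W W') (f : V ~> W) :
    W' ~> V' :=
  runit V' ∘ (idm V' ⊠ ev b) ∘ assoc V' W W' ∘ ((idm V' ⊠ f) ⊠ idm W')
    ∘ (coev a ⊠ idm W') ∘ lunitV W'.

Definition ldagger V V' W W' (a : adj V' V) (b : adj W' W) (f : V ~> W) :
    W' ~> V' :=
  lunit V' ∘ (ev b ⊠ idm V') ∘ ((idm W' ⊠ f) ⊠ idm V') ∘ assocV W' V V'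
    ∘ (idm W' ⊠ coev a) ∘ runitV W'.

Definition nested_coev V V' W W' (hV : one ~> V' ⊗ V) (hW : one ~> W' ⊗ W) :
    one ~> (W' ⊗ V') ⊗ (V ⊗ W) :=
  assocV W' V' (V ⊗ W) ∘ (idm W' ⊠ assoc V' V W) ∘ (idm W' ⊠ (hV ⊠ idm W))
    ∘ (idm W' ⊠ lunitV W) ∘ hW.

Definition nested_ev V V' W W' (eV : V ⊗ V' ~> one) (eW : W ⊗ W' ~> one) :
    (V ⊗ W) ⊗ (W' ⊗ V') ~> one :=
  eV ∘ (idm V ⊠ lunit V') ∘ (idm V ⊠ (eW ⊠ idm V')) ∘ (idm V ⊠ assocV W W' V')
    ∘ assoc V W (W' ⊗ V').

End Duality.

(* The nested pairs and the unitors of [one] satisfy the snake equations. A pair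
   (h, e) acts on every object Z, by Z -> V' ⊗ (V ⊗ Z) and V ⊗ (V' ⊗ Z) -> Z, and
   the snake equations are the triangle identities of this action. *)
Section NestedDuality.
Variables (K : fieldType) (C : monCat K).
Implicit Types (U V W Z : C).

Lemma comp_cut U V W Z (g : V ~> W) (f : U ~> V) (h : U ~> W) :
  g ∘ f = h -> forall k : Z ~> U, g ∘ (f ∘ k) = h ∘ k.
Proof. by move=> E k; rewrite compA E. Qed.

Lemma comp_cut2 U V V' W Z (g : V ~> W) (f : U ~> V) (g' : V' ~> W) (f' : U ~> V') :
  g ∘ f = g' ∘ f' -> forall k : Z ~> U, g ∘ (f ∘ k) = g' ∘ (f' ∘ k).
Proof. by move=> E k; rewrite !compA E. Qed.

Lemma whiskM_l V U W Z (g : W ~> Z) (f : U ~> W) :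
  idm V ⊠ (g ∘ f) = (idm V ⊠ g) ∘ (idm V ⊠ f).
Proof. by rewrite -thomM comp1m. Qed.

Lemma whiskM_r V U W Z (g : W ~> Z) (f : U ~> W) :
  (g ∘ f) ⊠ idm V = (g ⊠ idm V) ∘ (f ⊠ idm V).
Proof. by rewrite -thomM comp1m. Qed.

Lemma whisk_exch U V W Z (f : U ~> V) (g : W ~> Z) :
  (f ⊠ idm Z) ∘ (idm U ⊠ g) = (idm V ⊠ g) ∘ (f ⊠ idm W).
Proof. by rewrite -!thomM !comp1m !compm1. Qed.

Lemma epi_cancel U V W (i : U ~> V) (j : V ~> U) (f g : V ~> W) :
  i ∘ j = idm V -> f ∘ i = g ∘ i -> f = g.
Proof. by move=> ij E; rewrite -(compm1 f) -(compm1 g) -ij !compA E. Qed.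

Lemma mono_cancel U V W (i : V ~> W) (j : W ~> V) (f g : U ~> V) :
  j ∘ i = idm V -> i ∘ f = i ∘ g -> f = g.
Proof. by move=> ij E; rewrite -(comp1m f) -(comp1m g) -ij -!compA E. Qed.

Lemma whisk_one_inj V W (f g : V ~> W) : idm one ⊠ f = idm one ⊠ g -> f = g.
Proof.
move=> E; apply: (epi_cancel (lunitVK V)).
by rewrite -!lunit_nat E.
Qed.

Lemma whisk_inj_one V W (f g : V ~> W) : f ⊠ idm one = g ⊠ idm one -> f = g.
Proof.
move=> E; apply: (epi_cancel (runitVK V)).
by rewrite -!runit_nat E.
Qed.

Lemma assocV_nat U V W U' V' W' (f : U ~> U') (g : V ~> V') (h : W ~> W') :
  assocV U' V' W' ∘ (f ⊠ (g ⊠ h)) = ((f ⊠ g) ⊠ h) ∘ assocV U V W.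
Proof.
apply: (epi_cancel (assocVK U V W)).
by rewrite -!compA assocK compm1 -assoc_nat compA assocK comp1m.
Qed.

Lemma lunitV_nat V W (f : V ~> W) : lunitV W ∘ f = (idm one ⊠ f) ∘ lunitV V.
Proof.
apply: (epi_cancel (lunitVK V)).
by rewrite -!compA lunitK compm1 -lunit_nat compA lunitK comp1m.
Qed.

Lemma lunit_tensor V W : lunit (V ⊗ W) ∘ assoc one V W = lunit V ⊠ idm W.
Proof.
apply: whisk_one_inj.
apply: (@epi_cancel _ _ _ (assoc one (one ⊗ V) W) (assocV one (one ⊗ V) W)).
  exact: assocVK.
apply: (@epi_cancel _ _ _ (assoc one one V ⊠ idm W) (assocV one one V ⊠ idm W)).
  by rewrite -whiskM_r assocVK thom1.
rewrite whiskM_l -!compA [(idm one ⊠ assoc _ _ _) ∘ _]compA -pentagon.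
rewrite compA triangle -(thom1 V W) -assoc_nat.
by rewrite compA -assoc_nat -compA -whiskM_r triangle.
Qed.

Lemma lunit_one : lunit (one : C) = runit one.
Proof.
apply: whisk_inj_one; rewrite -triangle -lunit_tensor; congr (_ ∘ _).
by apply: (mono_cancel (lunitK _)); rewrite lunit_nat.
Qed.

Lemma lunitV_tensor V W : assocV one V W ∘ lunitV (V ⊗ W) = lunitV V ⊠ idm W.
Proof.
apply: (@mono_cancel _ _ _ (lunit V ⊠ idm W) (lunitV V ⊠ idm W)).
  by rewrite -whiskM_r lunitK thom1.
rewrite -{1}lunit_tensor -!compA (comp_cut (assocVK _ _ _)) comp1m lunitVK.
by rewrite -whiskM_r lunitVK thom1.
Qed.

Lemma triangleV V W :
  assocV V one W ∘ (idm V ⊠ lunitV W) = runitV V ⊠ idm W.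
Proof.
apply: (@mono_cancel _ _ _ (runit V ⊠ idm W) (runitV V ⊠ idm W)).
  by rewrite -whiskM_r runitK thom1.
rewrite -{1}triangle -!compA (comp_cut (assocVK _ _ _)) comp1m -whiskM_l.
by rewrite lunitVK -whiskM_r runitVK !thom1.
Qed.

Lemma pentagonV U V W Z :
  assocV (U ⊗ V) W Z ∘ assocV U V (W ⊗ Z) =
  (assocV U V W ⊠ idm Z) ∘ assocV U (V ⊗ W) Z ∘ (idm U ⊠ assocV V W Z).
Proof.
apply: (@epi_cancel _ _ _ (assoc U V (W ⊗ Z) ∘ assoc (U ⊗ V) W Z)
   (assocV (U ⊗ V) W Z ∘ assocV U V (W ⊗ Z))).
  by rewrite -!compA (comp_cut (assocVK _ _ _)) comp1m assocVK.
rewrite -compA (comp_cut (assocK _ _ _)) comp1m assocK pentagon -!compA.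
rewrite (comp_cut (esym (whiskM_l _ _ _))) assocK thom1 comp1m.
by rewrite (comp_cut (assocK _ _ _)) comp1m -whiskM_r assocK thom1.
Qed.

Definition act_coev V V' (h : one ~> V' ⊗ V) Z : Z ~> V' ⊗ (V ⊗ Z) :=
  locked (assoc V' V Z ∘ (h ⊠ idm Z) ∘ lunitV Z).

Definition act_ev V V' (e : V ⊗ V' ~> one) Z : V ⊗ (V' ⊗ Z) ~> Z :=
  locked (lunit Z ∘ (e ⊠ idm Z) ∘ assocV V V' Z).

Lemma act_coev_nat V V' (h : one ~> V' ⊗ V) Z Z' (f : Z ~> Z') :
  act_coev h Z' ∘ f = (idm V' ⊠ (idm V ⊠ f)) ∘ act_coev h Z.
Proof.
rewrite /act_coev -!lock -!compA lunitV_nat (comp_cut2 (whisk_exch _ _)).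
by rewrite -thom1 (comp_cut2 (assoc_nat _ _ _)).
Qed.

Lemma act_ev_nat V V' (e : V ⊗ V' ~> one) Z Z' (f : Z ~> Z') :
  act_ev e Z' ∘ (idm V ⊠ (idm V' ⊠ f)) = f ∘ act_ev e Z.
Proof.
rewrite /act_ev -!lock -!compA assocV_nat thom1 (comp_cut2 (whisk_exch _ _)).
by rewrite (comp_cut2 (lunit_nat _)).
Qed.

Lemma pentagon_mid U V W Z :
  assoc (U ⊗ V) W Z ∘ (assocV U V W ⊠ idm Z) ∘ assocV U (V ⊗ W) Z =
  assocV U V (W ⊗ Z) ∘ (idm U ⊠ assoc V W Z).
Proof.
apply: (@mono_cancel _ _ _ (assocV (U ⊗ V) W Z) (assoc (U ⊗ V) W Z)).
  exact: assocVK.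
rewrite !compA pentagonV assocK comp1m -!compA -whiskM_l assocK thom1.
by rewrite compm1.
Qed.

Lemma pentagon_midV U V W Z :
  assoc U (V ⊗ W) Z ∘ (assoc U V W ⊠ idm Z) ∘ assocV (U ⊗ V) W Z =
  (idm U ⊠ assocV V W Z) ∘ assoc U V (W ⊗ Z).
Proof.
apply: (@epi_cancel _ _ _ (assoc (U ⊗ V) W Z) (assocV (U ⊗ V) W Z)).
  exact: assocVK.
rewrite -!compA assocK compm1 pentagon -compA.
by rewrite (comp_cut (esym (whiskM_l _ _ _))) assocK thom1 comp1m.
Qed.

Lemma act_snake1 V V' (h : one ~> V' ⊗ V) (e : V ⊗ V' ~> one) Z :
  act_ev e (V ⊗ Z) ∘ (idm V ⊠ act_coev h Z) = snake1 h e ⊠ idm Z.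
Proof.
rewrite /snake1 /act_ev /act_coev -!lock !whiskM_r !whiskM_l -triangleV -!compA.
rewrite -lunit_tensor -!compA [in RHS](comp_cut2 (assoc_nat _ _ _)) thom1.
rewrite (comp_cut2 (esym (assocV_nat _ _ _))).
by rewrite (comp_cut2 (esym (pentagon_mid _ _ _ _))) -!compA.
Qed.

Lemma act_snake2 V V' (h : one ~> V' ⊗ V) (e : V ⊗ V' ~> one) Z :
  (idm V' ⊠ act_ev e Z) ∘ act_coev h (V' ⊗ Z) = snake2 h e ⊠ idm Z.
Proof.
rewrite /snake2 /act_ev /act_coev -!lock !whiskM_r !whiskM_l -lunitV_tensor -!compA.
rewrite -triangle -!compA [in RHS](comp_cut2 (assoc_nat _ _ _)).
rewrite (comp_cut2 (esym (assocV_nat _ _ _))) thom1.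
by rewrite -(comp_cut2 (pentagon_midV _ _ _ _)) -!compA.
Qed.

Lemma snake1P V V' (h : one ~> V' ⊗ V) (e : V ⊗ V' ~> one) :
  snake1 h e = idm V <->
  forall Z, act_ev e (V ⊗ Z) ∘ (idm V ⊠ act_coev h Z) = idm (V ⊗ Z).
Proof.
split=> [E Z|E]; first by rewrite act_snake1 E thom1.
by apply: whisk_inj_one; rewrite -act_snake1 E thom1.
Qed.

Lemma snake2P V V' (h : one ~> V' ⊗ V) (e : V ⊗ V' ~> one) :
  snake2 h e = idm V' <->
  forall Z, (idm V' ⊠ act_ev e Z) ∘ act_coev h (V' ⊗ Z) = idm (V' ⊗ Z).
Proof.
split=> [E Z|E]; first by rewrite act_snake2 E thom1.
by apply: whisk_inj_one; rewrite -act_snake2 E thom1.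
Qed.

Lemma act_coev_whisk V V' (h : one ~> V' ⊗ V) W Z :
  assoc V' (V ⊗ W) Z ∘ (act_coev h W ⊠ idm Z) =
  (idm V' ⊠ assocV V W Z) ∘ act_coev h (W ⊗ Z).
Proof.
rewrite /act_coev -!lock !whiskM_r -lunitV_tensor -!compA.
rewrite [in LHS](comp_cut2 (esym (assocV_nat _ _ _))) thom1.
by rewrite -(comp_cut2 (pentagon_midV _ _ _ _)) -!compA.
Qed.

Lemma act_ev_whisk V V' (e : V ⊗ V' ~> one) W Z :
  act_ev e W ⊠ idm Z =
  act_ev e (W ⊗ Z) ∘ (idm V ⊠ assoc V' W Z) ∘ assoc V (V' ⊗ W) Z.
Proof.
rewrite /act_ev -!lock !whiskM_r -lunit_tensor -!compA.
rewrite (comp_cut2 (assoc_nat _ _ _)) thom1.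
rewrite (comp_cut2 (esym (pentagon_mid _ _ _ _))) -!compA.
by rewrite assocK compm1.
Qed.

Lemma nested_coevE V V' W W' (hV : one ~> V' ⊗ V) (hW : one ~> W' ⊗ W) :
  nested_coev hV hW =
  assocV W' V' (V ⊗ W) ∘ (idm W' ⊠ act_coev hV W) ∘ hW.
Proof. by rewrite /nested_coev /act_coev -!lock !whiskM_l -!compA. Qed.

Lemma nested_evE V V' W W' (eV : V ⊗ V' ~> one) (eW : W ⊗ W' ~> one) :
  nested_ev eV eW =
  eV ∘ (idm V ⊠ act_ev eW V') ∘ assoc V W (W' ⊗ V').
Proof. by rewrite /nested_ev /act_ev -!lock !whiskM_l -!compA. Qed.

Lemma act_nested_coev V V' W W' (hV : one ~> V' ⊗ V) (hW : one ~> W' ⊗ W) Z :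
  act_coev (nested_coev hV hW) Z =
  assocV W' V' ((V ⊗ W) ⊗ Z) ∘ (idm W' ⊠ (idm V' ⊠ assocV V W Z))
    ∘ (idm W' ⊠ act_coev hV (W ⊗ Z)) ∘ act_coev hW Z.
Proof.
rewrite -[_ ∘ _ ∘ (idm W' ⊠ _)]compA -whiskM_l -act_coev_whisk whiskM_l.
rewrite nested_coevE; move: (act_coev hV W) => X.
rewrite /act_coev -!lock !whiskM_r -!compA.
rewrite -[in RHS](comp_cut2 (assoc_nat _ _ _)).
by rewrite -(comp_cut2 (pentagon_mid _ _ _ _)) -!compA
  (comp_cut (assocK _ _ _)) comp1m.
Qed.

Lemma act_nested_ev V V' W W' (eV : V ⊗ V' ~> one) (eW : W ⊗ W' ~> one) Z :
  act_ev (nested_ev eV eW) Z =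
  act_ev eV Z ∘ (idm V ⊠ act_ev eW (V' ⊗ Z))
    ∘ (idm V ⊠ (idm W ⊠ assoc W' V' Z)) ∘ assoc V W ((W' ⊗ V') ⊗ Z).
Proof.
rewrite -[_ ∘ (idm V ⊠ (idm W ⊠ _))]compA -whiskM_l.
have -> : act_ev eW (V' ⊗ Z) ∘ (idm W ⊠ assoc W' V' Z) =
  (act_ev eW V' ⊠ idm Z) ∘ assocV W (W' ⊗ V') Z.
  by rewrite act_ev_whisk -!compA assocVK compm1.
rewrite nested_evE.
move: (act_ev eW V') => X.
rewrite /act_ev -!lock !whiskM_r whiskM_l -!compA -pentagon_midV -!compA.
by rewrite (comp_cut2 (assocV_nat _ _ _)) (comp_cut (assocK _ _ _)) comp1m.
Qed.

Lemma nested_snake1 V V' W W' (a : adj V V') (b : adj W W') :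
  snake1 (nested_coev (coev a) (coev b)) (nested_ev (ev a) (ev b)) =
  idm (V ⊗ W).
Proof.
have /snake1P Ea := adj_snake1 a; have /snake1P Eb := adj_snake1 b.
apply/snake1P => Z; rewrite act_nested_ev.
set X := act_coev _ Z.
have EX : act_ev (ev b) (V' ⊗ (V ⊗ W ⊗ Z)) ∘
    (idm W ⊠ (assoc W' V' (V ⊗ W ⊗ Z) ∘ X)) =
    (idm V' ⊠ assocV V W Z) ∘ act_coev (coev a) (W ⊗ Z).
  rewrite /X act_nested_coev -!compA (comp_cut (assocVK _ _ _)) comp1m.
  rewrite (comp_cut (esym (whiskM_l _ _ _))).
  set Y := _ ∘ act_coev (coev a) _.
  rewrite whiskM_l.
  by rewrite (comp_cut2 (act_ev_nat _ _)) Eb compm1.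
rewrite -!compA -[idm (V ⊗ W)]thom1 assoc_nat.
rewrite 2!(comp_cut (esym (whiskM_l _ _ _))) -compA -whiskM_l EX whiskM_l -compA.
by rewrite (comp_cut2 (act_ev_nat _ _)) (comp_cut (Ea _)) comp1m assocK.
Qed.

Lemma nested_snake2 V V' W W' (a : adj V V') (b : adj W W') :
  snake2 (nested_coev (coev a) (coev b)) (nested_ev (ev a) (ev b)) =
  idm (W' ⊗ V').
Proof.
have /snake2P Ea := adj_snake2 a; have /snake2P Eb := adj_snake2 b.
apply/snake2P => Z; rewrite act_nested_coev.
apply: (@mono_cancel _ _ _ (assoc W' V' Z) (assocV W' V' Z)).
  exact: assocK.
rewrite compm1 -[idm (W' ⊗ V')]thom1 -!compA.
rewrite (comp_cut2 (assoc_nat _ _ _)) (comp_cut (assocVK _ _ _)) comp1m.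
rewrite (comp_cut (esym (whiskM_l _ _ _))) -whiskM_l act_nested_ev -!compA.
rewrite assocVK compm1 -whiskM_l whiskM_l (comp_cut (esym (whiskM_l _ _ _))).
rewrite -compA -act_coev_nat compA Ea comp1m whiskM_l -compA -act_coev_nat.
by rewrite compA Eb comp1m.
Qed.

Lemma one_snake1 : snake1 (lunitV one) (lunit one) = idm (one : C).
Proof.
rewrite /snake1 -!compA (comp_cut (triangleV _ _)) lunit_one.
rewrite (comp_cut (esym (whiskM_r _ _ _))) runitVK thom1 comp1m.
by rewrite runitVK.
Qed.

Lemma one_snake2 : snake2 (lunitV one) (lunit one) = idm (one : C).
Proof.
rewrite /snake2 -!compA (comp_cut (triangle _ _)) -lunit_one.
rewrite (comp_cut (esym (whiskM_r _ _ _))) lunitVK thom1 comp1m.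
by rewrite lunitVK.
Qed.

Definition nested_adj V V' W W' (a : adj V V') (b : adj W W') :
    adj (V ⊗ W) (W' ⊗ V') :=
  Adj (nested_snake1 a b) (nested_snake2 a b).

Definition one_adj : adj (one : C) one := Adj one_snake1 one_snake2.

End NestedDuality.

Section EvenHanded.
Variables (K : fieldType) (C : monCat K).
Implicit Types V W : C.

Record evenHanded := EvenHanded {
  eh_map :> forall V V', adj V V' -> adj V' V;
  eh_invol : forall V V' (a : adj V V'), eh_map (eh_map a) = a;
  eh_tensor : forall V V' W W' (a : adj V V') (b : adj W W'),
    eh_map (nested_adj a b) = nested_adj (eh_map b) (eh_map a);
  eh_one : eh_map (one_adj C) = one_adj C;
  eh_dagger : forall V V' W W' (a : adj V V') (b : adj W W') (f : V ~> W),
    rdagger a b f = ldagger (eh_map a) (eh_map b) f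
}.

Definition spherical (Psi : evenHanded) :=
  forall V V' (a : adj V V') (f : V ~> V),
    ev (Psi V V' a) ∘ (idm V' ⊠ f) ∘ coev a =
    ev a ∘ (f ⊠ idm V') ∘ coev (Psi V V' a).

End EvenHanded.

Section Semisimple.
Variables (K : fieldType) (C : linCat K).
Implicit Types V W : C.

Definition isomorphic V W :=
  exists (f : V ~> W) (g : W ~> V), g ∘ f = idm V /\ f ∘ g = idm W.

Definition simple V := \dim {: V ~> V} = 1%N.

Definition is_direct_sum n (Y : 'I_n -> C) V :=
  exists (inj : forall k, Y k ~> V) (prj : forall k, V ~> Y k),
    [/\ forall k, prj k ∘ inj k = idm (Y k),
        forall k l, k != l -> prj k ∘ inj l = 0
      & \sum_(k < n) inj k ∘ prj k = idm V].

Definition semisimple :=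
  [/\ forall n (Y : 'I_n -> C), exists V, is_direct_sum Y V,
      forall V, exists n (Y : 'I_n -> C),
        (forall k, simple (Y k)) /\ is_direct_sum Y V
    & forall V W, simple V -> simple W -> ~ isomorphic V W ->
        forall f : V ~> W, f = 0].

End Semisimple.

Record fusionCat (K : fieldType) := FusionCat {
  fcat :> monCat K;
  fus_semisimple : semisimple fcat;
  fus_rigid : forall V : fcat,
    (exists V', inhabited (adj V V')) /\ (exists V', inhabited (adj V' V));
  fus_finite : exists n (Y : 'I_n -> fcat),
    forall V, simple V -> exists k, isomorphic V (Y k);
  fus_unit : simple (one : fcat)
}.

(* Representatives X_i of the simple objects; the index 0 is that of the unit
   object, and [star i] is the index i* of the dual of X_i. *)
Record simpleReps (K : fieldType) (C : fusionCat K) := SimpleReps {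
  idx : finType;
  rep :> idx -> C;
  rep_simple : forall i, simple (rep i);
  rep_inj : forall i j, isomorphic (rep i) (rep j) -> i = j;
  rep_surj : forall V : C, simple V -> exists i, isomorphic V (rep i);
  idx0 : idx;
  rep_idx0 : isomorphic (rep idx0) one;
  star : idx -> idx;
  rep_star : forall i, inhabited (adj (rep i) (rep (star i)))
}.
Arguments idx0 {K C} s.
Arguments star {K C} s i.

Section Pairing.
Variables (K : fieldType) (C : fusionCat K) (X : simpleReps C).
Implicit Types i j k : idx X.

(* The identification End(1) = K: the coordinate on the basis (id_1). *)
Definition scal (f : (one : C) ~> one) : K := coord [tuple idm one] ord0 f.

Definition paired_dim (V V' : C) (a : adj V V') (b : adj V' V) : K :=
  scal (ev b ∘ coev a) * scal (ev a ∘ coev b).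

(* Since the paired dimension of the unit is 1, this leaves d_0 = 1 or d_0 = -1;
   the involutions define pivotal symbols (eps^0_ii* = 1) only when d_0 = 1. *)
Definition root_choice (d : idx X -> K) :=
  (forall i V' (a : adj (X i) V') (b : adj V' (X i)),
     d i ^+ 2 = paired_dim a b) /\
  (forall i, d i = d (star X i)).

Definition partner (d : idx X -> K) i V' (a : adj (X i) V') (b : adj V' (X i)) :=
  scal (ev b ∘ coev a) = d i.

(* Duals of all the X_i, with unit-counit pairs and their partners. *)
Record dualChoice (d : idx X -> K) := DualChoice {
  dobj : idx X -> C;
  dadj : forall i, adj (X i) (dobj i);
  padj : forall i, adj (dobj i) (X i);
  padjP : forall i, partner d (dadj i) (padj i)
}.

Definition involution_op (d : idx X -> K) (D : dualChoice d) i j k (v : X i ~> X j ⊗ X k) :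
    X i ~> X j ⊗ X k :=
  let vdag := rdagger (dadj D i) (nested_adj (dadj D j) (dadj D k)) v in
  rdagger (nested_adj (padj D k) (padj D j)) (padj D i) vdag.

(* N^i_jk, the multiplicity of X_i in X_j ⊗ X_k. *)
Definition fusion_coef i j k : nat := \dim {: X i ~> X j ⊗ X k}.

Definition is_sign (x : K) := x = 1 \/ x = -1.

Definition twistedAut (eps : idx X -> idx X -> idx X -> K) :=
  {t : idx X -> K | (forall i, t i != 0) /\
     forall i j k, fusion_coef i j k != 0%N -> t j * t k = eps i j k * t i}.

(* Only the values at the triples with N^i_jk <> 0 matter, in [pivotal_symbols]
   and in [piv_equiv]; [eps i j k] stands for eps^i_jk. *)
Definition pivotal_symbols (eps : idx X -> idx X -> idx X -> K) :=
  [/\ forall i j k, fusion_coef i j k != 0%N -> is_sign (eps i j k),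
      forall i j k, fusion_coef i j k != 0%N ->
        eps i j k = eps (star X k) (star X i) j,
      forall i j k, fusion_coef i j k != 0%N ->
        eps i j k = eps (star X i) (star X k) (star X j)
    & forall i, eps (idx0 X) i (star X i) = 1].

Definition piv_equiv (eps eps' : idx X -> idx X -> idx X -> K) :=
  exists f : idx X -> K,
    [/\ forall i, is_sign (f i),
        f (idx0 X) = 1,
        forall i, f i = f (star X i)
      & forall i j k, fusion_coef i j k != 0%N ->
          eps' i j k = f i * f j * f k * eps i j k].

(* [eps] = 0 in H_piv([C], Z/2). *)
Definition piv_trivial (eps : idx X -> idx X -> idx X -> K) :=
  piv_equiv eps (fun _ _ _ => 1).

End Pairing.
Arguments partner {K C X} d {i V'} a b.

(* Main.v *)
Require Import Defs.
From HB Require Import structures.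
From mathcomp Require Import all_boot all_order all_algebra.
From mathcomp Require Import boolp reals complex.
Set Implicit Arguments. Unset Strict Implicit. Unset Printing Implicit Defensive.
Import GRing.Theory Defs.
Local Open Scope ring_scope.
Local Open Scope cat_scope.

(** Fix right duals and left duals of V and W. Transposing f : V -> W with the
    right duals gives a map W' -> V', and transposing that one with the left
    duals gives a map V -> W again, the double dual [ddual f]. Everything in the
    theorem is a statement about this operation. It is functorial, it is
    monoidal for the nested duals, and it fixes the associators, the unitors and
    the units and counits. The involution operator T^i_jk is [ddual] on
    Hom(X_i, X_j ⊗ X_k), for duals balanced by the root choice; and since the
    left dagger of the statement inverts the second transposition
    ([rdagger_ldagger], [ldagger_rdagger]), the dagger axiom of an even-handed
    structure Psi says that [ddual f = f] for the duals (a, Psi a).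

    On a simple object two left dualities with the same underlying objects
    differ by a scalar, so Psi amounts to the scalars t_i by which Psi of the
    chosen right duality of X_i differs from its partner. Rescaling the left
    duals by t multiplies [ddual] on Hom(X_i, X_j ⊗ X_k) by t_i / (t_j t_k).
    Hence T^i_jk is the scalar t_j t_k / t_i ([scaled_ddual_rep]).

    This scalar c is a sign. If [ddual v = c v], moving v around the right trace
    costs a factor c and moving it around the left trace costs c^-1
    ([rtrace_cyclic], [ltrace_cyclic]). Both traces agree on X_i by the choice of
    the partners, and then they agree on X_j ⊗ X_k, because the partial traces
    on the two sides of a strand commute ([spherical_tensor]). So c = c^-1
    ([ddual_sqr]), which is the first part.

    Conversely, let t be twisted by the signs eps. Then [ddual] for the rescaled
    duals is the identity on all the maps X_i -> X_j ⊗ X_k. A left dual of V is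
    called compatible if [ddual] fixes all the maps X_i -> V. It exists and is
    unique for each right dual of V, because V is a direct sum of the X_i
    ([compat_exists], [compat_uniq]), and the axioms of an even-handed structure
    all follow from this uniqueness. Involutivity needs t_i t_i* = 1, which comes
    from eps^0_ii* = d_0 ([eps_unit]).

    For the last part, the two traces of the identity of X_i under Psi are
    t_i d_i and t_i^-1 d_i, so Psi is spherical exactly when every t_i is a sign,
    and such a t is a trivialisation of eps. The symmetries of eps hold because a
    rotation of v, or a transpose of a map dual to v, is built from v and from
    maps that [ddual] fixes ([eps_rot], [eps_dual]). *)

(** * Linearity *)

Section LinearMaps.
Variables (K : fieldType) (U V : lmodType K) (f : U -> V).
Hypothesis f_lin : linear f.

Lemma lin0 : f 0 = 0.
Proof. by have := f_lin (-1) 0 0; rewrite scaler0 addr0 scaleN1r addNr. Qed.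

Lemma linD x y : f (x + y) = f x + f y.
Proof. by have := f_lin 1 x y; rewrite !scale1r. Qed.

Lemma linZ c x : f (c *: x) = c *: f x.
Proof. by have := f_lin c x 0; rewrite !addr0 lin0 addr0. Qed.

Lemma lin_sum n (F : 'I_n -> U) : f (\sum_k F k) = \sum_k f (F k).
Proof. exact: (big_morph f linD lin0). Qed.

End LinearMaps.

Section LinearCategory.
Variables (K : fieldType) (C : linCat K).
Implicit Types U V W : C.

Lemma comp0r U V W (g : V ~> W) : g ∘ (0 : U ~> V) = 0.
Proof. exact: lin0 (comp_linear_r g). Qed.

Lemma comp0l U V W (f : U ~> V) : (0 : V ~> W) ∘ f = 0.
Proof. exact: lin0 (comp_linear_l f). Qed.

Lemma compZr U V W (g : V ~> W) c (f : U ~> V) : g ∘ (c *: f) = c *: (g ∘ f).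
Proof. exact: linZ (comp_linear_r g) _ _. Qed.

Lemma compZl U V W c (g : V ~> W) (f : U ~> V) : (c *: g) ∘ f = c *: (g ∘ f).
Proof. exact: linZ (comp_linear_l f) _ _. Qed.

Lemma comp_sumr U V W (g : V ~> W) n (F : 'I_n -> U ~> V) :
  g ∘ (\sum_k F k) = \sum_k g ∘ F k.
Proof. by rewrite (lin_sum (comp_linear_r g)). Qed.

Lemma comp_suml U V W n (F : 'I_n -> V ~> W) (f : U ~> V) :
  (\sum_k F k) ∘ f = \sum_k F k ∘ f.
Proof. by rewrite (lin_sum (comp_linear_l f)). Qed.

End LinearCategory.

Section LinearTensor.
Variables (K : fieldType) (C : monCat K).
Implicit Types V W : C.

Lemma thomZr V V' W W' (f : V ~> V') c (g : W ~> W') :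
  f ⊠ (c *: g) = c *: (f ⊠ g).
Proof. exact: linZ (thom_linear_r f) _ _. Qed.

Lemma thomZl V V' W W' c (f : V ~> V') (g : W ~> W') :
  (c *: f) ⊠ g = c *: (f ⊠ g).
Proof. exact: linZ (thom_linear_l g) _ _. Qed.

Lemma thom_sumr V V' W W' (f : V ~> V') n (G : 'I_n -> W ~> W') :
  f ⊠ (\sum_k G k) = \sum_k f ⊠ G k.
Proof. by rewrite (lin_sum (thom_linear_r f)). Qed.

Lemma thom_suml V V' W W' n (F : 'I_n -> V ~> V') (g : W ~> W') :
  (\sum_k F k) ⊠ g = \sum_k F k ⊠ g.
Proof. by rewrite (lin_sum (thom_linear_l g)). Qed.

End LinearTensor.

(** * Transposes of morphisms *)

Section Transpose.
Variables (K : fieldType) (C : monCat K).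
Implicit Types U V W Z : C.

Lemma runit_tensor V W : (idm V ⊠ runit W) ∘ assoc V W one = runit (V ⊗ W).
Proof.
apply: whisk_inj_one.
apply: (mono_cancel (assocK V W one)).
rewrite whiskM_r -triangle !compA assoc_nat -triangle whiskM_l.
rewrite -[in LHS]compA -[in LHS]compA [in LHS](compA (idm V ⊠ assoc _ _ _)) -pentagon.
by rewrite !compA -assoc_nat thom1.
Qed.

Lemma runitV_tensor V W : assoc V W one ∘ runitV (V ⊗ W) = idm V ⊠ runitV W.
Proof.
apply: (@mono_cancel _ _ _ _ _ (idm V ⊠ runit W) (idm V ⊠ runitV W)).
  by rewrite -whiskM_l runitK thom1.
by rewrite compA runit_tensor runitVK -whiskM_l runitVK thom1.
Qed.

Lemma runitV_nat V W (f : V ~> W) : runitV W ∘ f = (f ⊠ idm one) ∘ runitV V.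
Proof.
apply: (epi_cancel (runitVK V)).
by rewrite -!compA runitK compm1 -runit_nat compA runitK comp1m.
Qed.

Lemma lunitV_one : lunitV (one : C) = runitV one.
Proof.
apply: (mono_cancel (runitK (one : C))).
by rewrite runitVK -lunit_one lunitVK.
Qed.

(** Letting a pair (h, e) act on all the objects Z keeps the associators out of
    the calculations; taking Z to be the unit object gives back the pair. *)
Lemma act_ev_one V V' (e : V ⊗ V' ~> one) :
  act_ev e one = e ∘ (idm V ⊠ runit V').
Proof.
rewrite /act_ev -lock lunit_one runit_nat -runit_tensor -!compA.
by rewrite assocVK compm1.
Qed.

Lemma act_coev_one V V' (h : one ~> V' ⊗ V) :
  act_coev h one = (idm V' ⊠ runitV V) ∘ h.
Proof.
rewrite /act_coev -lock lunitV_one -compA -runitV_nat -runitV_tensor.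
by rewrite compA.
Qed.

Lemma act_ev_comp V V' W W' (e : V ⊗ V' ~> one) (f : W ~> V) (g : W' ~> V') Z :
  act_ev (e ∘ (f ⊠ g)) Z = act_ev e Z ∘ (f ⊠ (g ⊠ idm Z)).
Proof. by rewrite /act_ev -!lock whiskM_r -!compA assocV_nat. Qed.

Lemma act_coev_comp V V' W W' (h : one ~> V' ⊗ V) (f : V ~> W) (g : V' ~> W') Z :
  act_coev ((g ⊠ f) ∘ h) Z = (g ⊠ (f ⊠ idm Z)) ∘ act_coev h Z.
Proof.
by rewrite /act_coev -!lock whiskM_r -!compA -(comp_cut2 (assoc_nat _ _ _)).
Qed.

Lemma act_adj1 V V' (a : adj V V') Z :
  act_ev (ev a) (V ⊗ Z) ∘ (idm V ⊠ act_coev (coev a) Z) = idm (V ⊗ Z).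
Proof. by move: Z; apply/snake1P/adj_snake1. Qed.

Lemma act_adj2 V V' (a : adj V V') Z :
  (idm V' ⊠ act_ev (ev a) Z) ∘ act_coev (coev a) (V' ⊗ Z) = idm (V' ⊗ Z).
Proof. by move: Z; apply/snake2P/adj_snake2. Qed.

Lemma adj_act_ev V V' (a : adj V V') :
  act_ev (ev a) V ∘ (idm V ⊠ coev a) = runit V.
Proof.
have := adj_snake1 a; rewrite /snake1 /act_ev -lock => E.
by apply: (epi_cancel (runitK V)); rewrite runitVK.
Qed.

Lemma adj_act_coev V V' (a : adj V V') :
  (idm V' ⊠ ev a) ∘ act_coev (coev a) V' = runitV V'.
Proof.
have := adj_snake2 a; rewrite /snake2 /act_coev -lock -!compA => E.
by apply: (mono_cancel (runitK V')); rewrite runitVK.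
Qed.

Lemma rdaggerE V V' W W' (a : adj V V') (b : adj W W') (f : V ~> W) :
  rdagger a b f =
  runit V' ∘ (idm V' ⊠ (ev b ∘ (f ⊠ idm W'))) ∘ act_coev (coev a) W'.
Proof.
rewrite /rdagger /act_coev -lock whiskM_l -!compA.
by rewrite (comp_cut2 (assoc_nat _ _ _)).
Qed.

Lemma ev_rdagger V V' W W' (a : adj V V') (b : adj W W') (f : V ~> W) :
  ev a ∘ (idm V ⊠ rdagger a b f) = ev b ∘ (f ⊠ idm W').
Proof.
rewrite rdaggerE; move: (ev b ∘ _) => x.
rewrite !whiskM_l !compA -act_ev_one act_ev_nat.
by rewrite -compA act_adj1 compm1.
Qed.

(** Together with [ev_rdagger], this characterises the transpose by sliding it
    through the counit; the transposes of the structure maps are computed in this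
    way. *)
Lemma rdagger_uniq V V' W W' (a : adj V V') (b : adj W W') (f : V ~> W) g :
  ev a ∘ (idm V ⊠ g) = ev b ∘ (f ⊠ idm W') -> rdagger a b f = g.
Proof.
move=> E; rewrite rdaggerE -E whiskM_l -!compA -act_coev_nat.
by rewrite [(_ ⊠ _) ∘ _]compA adj_act_coev compA runitVK comp1m.
Qed.

Lemma rdagger_whisk V V' W W' (a : adj V V') (b : adj W W') (f : V ~> W) Z :
  rdagger a b f ⊠ idm Z =
  (idm V' ⊠ (act_ev (ev b) Z ∘ (f ⊠ idm (W' ⊗ Z)))) ∘ act_coev (coev a) (W' ⊗ Z).
Proof.
have act_coevZ : act_coev (coev a) W' ⊠ idm Z =
   assocV V' (V ⊗ W') Z ∘ ((idm V' ⊠ assocV V W' Z) ∘ act_coev (coev a) (W' ⊗ Z)).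
  by rewrite -act_coev_whisk compA assocK comp1m.
rewrite rdaggerE !whiskM_r act_coevZ -!compA.
rewrite -(comp_cut2 (assocV_nat _ _ _)) -triangle -!compA.
rewrite (comp_cut (assocVK _ _ _)) comp1m.
rewrite !(comp_cut (esym (whiskM_l _ _ _))); congr (_ ⊠ _ ∘ _).
by rewrite -(thom1 W' Z) -act_ev_comp /act_ev -lock.
Qed.

Lemma coev_rdagger V V' W W' (a : adj V V') (b : adj W W') (f : V ~> W) :
  (rdagger a b f ⊠ idm W) ∘ coev b = (idm V' ⊠ f) ∘ coev a.
Proof.
rewrite rdagger_whisk -compA act_coev_nat act_coev_one.
rewrite !(comp_cut (esym (whiskM_l _ _ _))); congr (_ ⊠ _ ∘ _).
rewrite -!compA (comp_cut2 (whisk_exch _ _)) compA adj_act_ev.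
by rewrite -runitV_nat compA runitVK comp1m.
Qed.

Lemma rdagger_linear V V' W W' (a : adj V V') (b : adj W W') :
  linear (@rdagger K C V V' W W' a b).
Proof.
move=> c f g; rewrite !rdaggerE.
rewrite (thom_linear_l (idm W')) (comp_linear_r (ev b)).
by rewrite (thom_linear_r (idm V')) (comp_linear_r (runit V')) (comp_linear_l (act_coev _ _)).
Qed.

Lemma rdagger_comp V V' W W' Z Z' (a : adj V V') (b : adj W W') (c : adj Z Z')
    (g : W ~> Z) (f : V ~> W) :
  rdagger a c (g ∘ f) = rdagger a b f ∘ rdagger b c g.
Proof.
apply: rdagger_uniq; rewrite whiskM_l compA ev_rdagger -compA whisk_exch.
by rewrite compA ev_rdagger -compA -whiskM_r.
Qed.

Lemma rdagger_id V V' (a : adj V V') : rdagger a a (idm V) = idm V'.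
Proof. exact: rdagger_uniq. Qed.

Lemma ldaggerE V V' W W' (a : adj V' V) (b : adj W' W) (f : V ~> W) :
  ldagger a b f =
  act_ev (ev b) V' ∘ (idm W' ⊠ ((f ⊠ idm V') ∘ coev a)) ∘ runitV W'.
Proof.
rewrite /ldagger /act_ev -lock whiskM_l -!compA.
by rewrite (comp_cut2 (assocV_nat _ _ _)).
Qed.

Lemma ldagger_rdagger V V' W W' (a : adj V' V) (b : adj W' W) (g : W' ~> V') :
  ldagger a b (rdagger b a g) = g.
Proof.
rewrite ldaggerE coev_rdagger whiskM_l compA act_ev_nat -!compA.
by rewrite [act_ev _ _ ∘ _]compA adj_act_ev runitVK compm1.
Qed.

(** The left dagger slides through the units, so transposing it back leaves a
    zigzag, which is straightened by a snake equation. *)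
Lemma rdagger_ldagger V V' W W' (a : adj V' V) (b : adj W' W) (f : V ~> W) :
  rdagger b a (ldagger a b f) = f.
Proof.
have E : (idm W ⊠ ldagger a b f) ∘ coev b = (f ⊠ idm V') ∘ coev a.
  rewrite ldaggerE; move: ((f ⊠ _) ∘ _) => x.
  rewrite !whiskM_l -!compA -act_coev_one -act_coev_nat.
  by rewrite compA act_adj2 comp1m.
rewrite /rdagger -[_ ∘ (coev b ⊠ _)]compA -whiskM_r E whiskM_r.
rewrite compA -[_ ∘ ((f ⊠ _) ⊠ _)]compA assoc_nat !compA.
rewrite -[_ ∘ (f ⊠ _)]compA thom1 -whisk_exch compA runit_nat -!compA.
have := adj_snake2 a; rewrite /snake2 -!compA => ->.
exact: compm1.
Qed.

(** The unit of a duality is determined by its counit: if the counits agree, the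
    transpose of the identity from one duality to the other is the identity. *)
Lemma adj_ext V V' (a b : adj V V') : ev a = ev b -> a = b.
Proof.
move=> E; have id_ba : rdagger a b (idm V) = idm V'.
  by apply: rdagger_uniq; rewrite E.
have := coev_rdagger a b (idm V); rewrite id_ba !thom1 !comp1m.
case: a b E {id_ba} => h e s1 s2 [h' e' s1' s2'] /= E1 E2.
by subst; congr Adj; apply: Prop_irrelevance.
Qed.

(** * Transposes of the structure morphisms *)

Lemma ev_nested V V' W W' (a : adj V V') (b : adj W W') :
  ev (nested_adj a b) =
  ev a ∘ ((idm V ⊠ act_ev (ev b) V') ∘ assoc V W (W' ⊗ V')).
Proof. by rewrite /= nested_evE -compA. Qed.

Lemma assoc_whisk U V W Z (h : W ~> Z) :
  assoc U V Z ∘ (idm (U ⊗ V) ⊠ h) = (idm U ⊠ (idm V ⊠ h)) ∘ assoc U V W.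
Proof. by rewrite -thom1 assoc_nat. Qed.

Lemma rdagger_tensor V V' W W' V1 V1' W1 W1' (a : adj V V') (b : adj W W')
    (a1 : adj V1 V1') (b1 : adj W1 W1') (f : V ~> V1) (g : W ~> W1) :
  rdagger (nested_adj a b) (nested_adj a1 b1) (f ⊠ g) =
  rdagger b b1 g ⊠ rdagger a a1 f.
Proof.
set Rf := rdagger a a1 f; set Rg := rdagger b b1 g.
have act_g Z : act_ev (ev b) Z ∘ (idm W ⊠ (Rg ⊠ idm Z)) =
               act_ev (ev b1) Z ∘ (g ⊠ (idm W1' ⊠ idm Z)).
  by rewrite -!act_ev_comp ev_rdagger.
apply: rdagger_uniq; rewrite !ev_nested -!compA -(thom1 V W) assoc_nat.
rewrite assoc_nat !compA; congr (_ ∘ _); rewrite -!compA.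
have -> : Rg ⊠ Rf = (Rg ⊠ idm V') ∘ (idm W1' ⊠ Rf) by rewrite -thomM comp1m compm1.
have act_gf : act_ev (ev b) V' ∘ (idm W ⊠ ((Rg ⊠ idm V') ∘ (idm W1' ⊠ Rf))) =
              Rf ∘ (act_ev (ev b1) V1' ∘ (g ⊠ idm (W1' ⊗ V1'))).
  rewrite whiskM_l compA act_g -compA thom1 whisk_exch compA act_ev_nat.
  by rewrite -compA.
rewrite -whiskM_l act_gf whiskM_l compA ev_rdagger -compA.
by rewrite -!thomM !comp1m !compm1.
Qed.

Lemma rdagger_ev V V' (a : adj V V') (b : adj V' V) :
  rdagger (nested_adj a b) (one_adj C) (ev a) = coev b.
Proof.
apply: rdagger_uniq; rewrite ev_nested -!compA -thom1 assoc_nat.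
rewrite [(_ ⊠ act_ev _ _) ∘ _]compA -whiskM_l adj_act_ev runit_tensor.
by rewrite /= lunit_one runit_nat.
Qed.

Lemma rdagger_coev V V' (a : adj V V') (b : adj V' V) :
  rdagger (one_adj C) (nested_adj a b) (coev b) = ev a.
Proof.
apply: rdagger_uniq; rewrite ev_nested /= lunit_nat -!compA; congr (_ ∘ _).
have := act_adj2 b V'; rewrite /act_coev -lock => E.
apply: (epi_cancel (lunitK _)); rewrite lunitVK -!compA.
by apply: esym; rewrite -[RHS]E -!compA.
Qed.

Lemma act_ev_nested V V' W W' (a : adj V V') (b : adj W W') Z :
  act_ev (ev (nested_adj a b)) Z =
  act_ev (ev a) Z ∘ ((idm V ⊠ act_ev (ev b) (V' ⊗ Z))
    ∘ ((idm V ⊠ (idm W ⊠ assoc W' V' Z)) ∘ assoc V W ((W' ⊗ V') ⊗ Z))).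
Proof. by rewrite act_nested_ev -!compA. Qed.

Lemma rdagger_assoc U U' V V' W W' (a : adj U U') (b : adj V V') (c : adj W W') :
  rdagger (nested_adj (nested_adj a b) c) (nested_adj a (nested_adj b c))
    (assoc U V W) = assoc W' V' U'.
Proof.
apply: rdagger_uniq; rewrite [ev (nested_adj a (nested_adj b c))]ev_nested.
rewrite [ev (nested_adj (nested_adj a b) c)]ev_nested.
rewrite act_ev_nested ev_nested !whiskM_l -!compA; congr (_ ∘ (_ ∘ _)).
by rewrite assoc_whisk !(comp_cut2 (assoc_whisk _ _ _)) pentagon -!compA.
Qed.

Lemma act_ev_lunit Z : act_ev (lunit (one : C)) Z = lunit Z ∘ lunit (one ⊗ Z).
Proof.
by rewrite /act_ev -lock lunit_one -triangle -!compA assocVK compm1 lunit_nat.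
Qed.

Lemma rdagger_lunit V V' (a : adj V V') :
  rdagger (nested_adj (one_adj C) a) a (lunit V) = runitV V'.
Proof.
apply: rdagger_uniq; rewrite ev_nested -lunit_tensor /= -!compA.
rewrite -thom1 assoc_nat.
rewrite [(_ ⊠ act_ev _ _) ∘ _]compA -whiskM_l act_ev_one -compA -whiskM_l runitVK.
by rewrite thom1 compm1 compA lunit_nat -compA.
Qed.

Lemma rdagger_runitV V V' (a : adj V V') :
  rdagger a (nested_adj a (one_adj C)) (runitV V) = lunit V'.
Proof.
apply: rdagger_uniq; rewrite ev_nested -triangleV /=.
rewrite -!compA (comp_cut (assocVK _ _ _)) comp1m -whiskM_l act_ev_lunit.
by rewrite -compA lunitVK compm1.
Qed.

End Transpose.

(** * Double duals *)

Section DoubleDual.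
Variables (K : fieldType) (C : monCat K).
Implicit Types U V W Z : C.

(** The two dualities are unrelated: [ddual] measures how they differ. *)
Record dualPair V := DualPair {
  pdual : C;
  radj : adj V pdual;
  ladj : adj pdual V
}.

Definition tensor_pair V W (P : dualPair V) (Q : dualPair W) : dualPair (V ⊗ W) :=
  DualPair (nested_adj (radj P) (radj Q)) (nested_adj (ladj Q) (ladj P)).

Definition one_pair : dualPair one := DualPair (one_adj C) (one_adj C).

Definition swap_pair V (P : dualPair V) : dualPair (pdual P) :=
  DualPair (ladj P) (radj P).

(** The functor V |-> V'' for the right duals is the identity on objects once V
    is used as the right dual of V', through [ladj]; this is its action on
    maps. *)
Definition ddual V W (P : dualPair V) (Q : dualPair W) (f : V ~> W) : V ~> W :=
  rdagger (ladj Q) (ladj P) (rdagger (radj P) (radj Q) f).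

Lemma ddual_linear V W (P : dualPair V) (Q : dualPair W) : linear (ddual P Q).
Proof. by move=> c f g; rewrite /ddual !rdagger_linear. Qed.

Lemma ddualZ V W (P : dualPair V) (Q : dualPair W) c f :
  ddual P Q (c *: f) = c *: ddual P Q f.
Proof. exact: linZ (ddual_linear P Q) _ _. Qed.

Lemma ddual0 V W (P : dualPair V) (Q : dualPair W) : ddual P Q 0 = 0.
Proof. exact: lin0 (ddual_linear P Q). Qed.

Lemma ddual_sum V W (P : dualPair V) (Q : dualPair W) n (F : 'I_n -> V ~> W) :
  ddual P Q (\sum_k F k) = \sum_k ddual P Q (F k).
Proof. by rewrite (lin_sum (ddual_linear P Q)). Qed.

Lemma ddual_id V (P : dualPair V) : ddual P P (idm V) = idm V.
Proof. by rewrite /ddual !rdagger_id. Qed.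

Lemma ddual_comp V W Z (P : dualPair V) (Q : dualPair W) (S : dualPair Z)
    (g : W ~> Z) (f : V ~> W) :
  ddual P S (g ∘ f) = ddual Q S g ∘ ddual P Q f.
Proof.
by rewrite /ddual (rdagger_comp _ (radj Q)) (rdagger_comp _ (ladj Q)).
Qed.

Lemma ddual_tensor V W V1 W1 (P : dualPair V) (Q : dualPair W) (P1 : dualPair V1)
    (Q1 : dualPair W1) (f : V ~> V1) (g : W ~> W1) :
  ddual (tensor_pair P Q) (tensor_pair P1 Q1) (f ⊠ g) =
  ddual P P1 f ⊠ ddual Q Q1 g.
Proof. by rewrite /ddual /= !rdagger_tensor. Qed.

Lemma ddual_assoc U V W (P : dualPair U) (Q : dualPair V) (S : dualPair W) :
  ddual (tensor_pair (tensor_pair P Q) S) (tensor_pair P (tensor_pair Q S))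
    (assoc U V W) = assoc U V W.
Proof. by rewrite /ddual /= !rdagger_assoc. Qed.

Lemma ddual_lunit V (P : dualPair V) :
  ddual (tensor_pair one_pair P) P (lunit V) = lunit V.
Proof. by rewrite /ddual /= rdagger_lunit rdagger_runitV. Qed.

Lemma ddual_ev V (P : dualPair V) :
  ddual (tensor_pair P (swap_pair P)) one_pair (ev (radj P)) = ev (radj P).
Proof. by rewrite /ddual /= rdagger_ev rdagger_coev. Qed.

Lemma ddual_inv V W (P : dualPair V) (Q : dualPair W) (f : V ~> W) (g : W ~> V) c :
    g ∘ f = idm V -> f ∘ g = idm W -> c != 0 -> ddual P Q f = c *: f ->
  ddual Q P g = c^-1 *: g.
Proof.
move=> gf fg c0 f_c; rewrite -[LHS]compm1 -fg.
have {1}-> : f = c^-1 *: ddual P Q f by rewrite f_c scalerA mulVf // scale1r.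
by rewrite compZl compZr compA -ddual_comp gf ddual_id comp1m.
Qed.

Lemma ddual_assocV U V W (P : dualPair U) (Q : dualPair V) (S : dualPair W) :
  ddual (tensor_pair P (tensor_pair Q S)) (tensor_pair (tensor_pair P Q) S)
    (assocV U V W) = assocV U V W.
Proof.
rewrite (ddual_inv (c := 1) (assocK _ _ _) (assocVK _ _ _)) ?oner_neq0 //.
  by rewrite invr1 scale1r.
by rewrite scale1r ddual_assoc.
Qed.

Lemma ddual_act_ev V W (P : dualPair V) (Q : dualPair W) :
  ddual (tensor_pair P (tensor_pair (swap_pair P) Q)) Q (act_ev (ev (radj P)) W) =
  act_ev (ev (radj P)) W.
Proof.
rewrite /act_ev -lock.
rewrite (ddual_comp _ (tensor_pair (tensor_pair P (swap_pair P)) Q)) ddual_assocV.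
rewrite (ddual_comp _ (tensor_pair one_pair Q)) ddual_lunit.
by rewrite ddual_tensor ddual_ev ddual_id.
Qed.

(** Transposition commutes with [ddual], when the dual objects carry the same
    dualities in the opposite roles. *)
Lemma ddual_swap V W (P : dualPair V) (Q : dualPair W) (f : V ~> W) :
  ddual (swap_pair Q) (swap_pair P) (rdagger (radj P) (radj Q) f) =
  rdagger (radj P) (radj Q) (ddual P Q f).
Proof. by []. Qed.

Lemma rdagger_eq0 V V' W W' (a : adj V V') (b : adj W W') (f : V ~> W) :
  rdagger a b f = 0 -> f = 0.
Proof.
move=> E; rewrite -(ldagger_rdagger b a f) E ldaggerE.
by rewrite (lin0 (thom_linear_l _)) comp0l (lin0 (thom_linear_r _)) comp0r comp0l.
Qed.

Definition rtrace V (P : dualPair V) (f : V ~> V) : (one : C) ~> one :=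
  ev (ladj P) ∘ (idm _ ⊠ f) ∘ coev (radj P).

Definition ltrace V (P : dualPair V) (f : V ~> V) : (one : C) ~> one :=
  ev (radj P) ∘ (f ⊠ idm _) ∘ coev (ladj P).

Lemma ev_ddual V W (P : dualPair V) (Q : dualPair W) (f : V ~> W) :
  ev (ladj Q) ∘ (idm _ ⊠ ddual P Q f) =
  ev (ladj P) ∘ (rdagger (radj P) (radj Q) f ⊠ idm V).
Proof. exact: ev_rdagger. Qed.

Lemma rtraceZ V (P : dualPair V) c f : rtrace P (c *: f) = c *: rtrace P f.
Proof. by rewrite /rtrace thomZr compZr compZl. Qed.

Lemma ltraceZ V (P : dualPair V) c f : ltrace P (c *: f) = c *: ltrace P f.
Proof. by rewrite /ltrace thomZl compZr compZl. Qed.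

Lemma rtrace_sum V (P : dualPair V) n (F : 'I_n -> V ~> V) :
  rtrace P (\sum_k F k) = \sum_k rtrace P (F k).
Proof. by rewrite /rtrace thom_sumr comp_sumr comp_suml. Qed.

Lemma ltrace_sum V (P : dualPair V) n (F : 'I_n -> V ~> V) :
  ltrace P (\sum_k F k) = \sum_k ltrace P (F k).
Proof. by rewrite /ltrace thom_suml comp_sumr comp_suml. Qed.

(** Sliding f around the closed strand replaces it by its double dual. *)
Lemma rtrace_cyclic V W (P : dualPair V) (Q : dualPair W) (f : V ~> W) (g : W ~> V) c :
  ddual P Q f = c *: f -> rtrace P (g ∘ f) = c *: rtrace Q (f ∘ g).
Proof.
move=> f_c; rewrite -rtraceZ -compZl -f_c /rtrace (whiskM_l _ g f).
rewrite (whiskM_l _ (ddual P Q f)) !compA ev_ddual.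
rewrite -!compA -(coev_rdagger _ (radj Q)); congr (_ ∘ _).
by rewrite !compA whisk_exch.
Qed.

(** On the left trace the strand is closed on the other side, so f is its own
    double dual transported backwards: the scalar appears inverted. *)
Lemma ltrace_cyclic V W (P : dualPair V) (Q : dualPair W) (f : V ~> W) (g : W ~> V) c :
  ddual P Q f = c *: f -> c *: ltrace P (g ∘ f) = ltrace Q (f ∘ g).
Proof.
move=> f_c; rewrite -ltraceZ -compZr -f_c /ltrace (whiskM_r _ f g).
rewrite (whiskM_r _ g) -!compA coev_rdagger !compA.
by rewrite -[_ ∘ (g ⊠ _) ∘ _]compA whisk_exch compA ev_rdagger.
Qed.

End DoubleDual.

(** * The traces of a tensor product *)

Section Sphere.
Variables (K : fieldType) (C : monCat K).
Variables (V W : C) (P : dualPair V) (Q : dualPair W).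
Local Notation V' := (pdual P).
Local Notation W' := (pdual Q).
Variable h : V ⊗ W ~> V ⊗ W.

(* The partial traces of [h]: V is closed on the left of W, and W on the right
   of V. *)
Let close_l : W ~> W :=
  act_ev (ev (ladj P)) W ∘ (idm V' ⊠ h) ∘ act_coev (coev (radj P)) W.

(* [h] next to a spectator strand W', which lets W be closed on the right. *)
Let mid : V ⊗ (W ⊗ W') ~> V ⊗ (W ⊗ W') :=
  assoc V W W' ∘ (h ⊠ idm W') ∘ assocV V W W'.

Let close_r : V ~> V :=
  runit V ∘ (idm V ⊠ ev (radj Q)) ∘ mid ∘ (idm V ⊠ coev (ladj Q)) ∘ runitV V.

Lemma rtrace_close_l : rtrace (tensor_pair P Q) h = rtrace Q close_l.
Proof.
rewrite /rtrace /= nested_evE nested_coevE /close_l; set x := act_ev _ _.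
set y := act_coev _ _; rewrite !whiskM_l -!compA; congr (_ ∘ (_ ∘ _)).
by rewrite -(thom1 W' V') (comp_cut2 (assoc_nat _ _ _)) (comp_cut (assocVK _ _ _)) comp1m.
Qed.

(** Both sides are the same planar diagram: V closed on the left and W on the
    right. *)
Lemma ltrace_close_l : ltrace Q close_l = rtrace P close_r.
Proof.
have close_lW : close_l ⊠ idm W' =
   act_ev (ev (ladj P)) (W ⊗ W') ∘ (idm V' ⊠ mid) ∘ act_coev (coev (radj P)) (W ⊗ W').
  rewrite /close_l !whiskM_r act_ev_whisk /mid !whiskM_l -!compA.
  rewrite -act_coev_whisk.
  by rewrite (comp_cut2 (assoc_nat _ _ _)).
rewrite /ltrace close_lW -!compA act_coev_nat.
rewrite [ev _ ∘ _]compA -act_ev_nat act_ev_one act_coev_one.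
by rewrite /rtrace /close_r; move: mid => m; rewrite !whiskM_l -!compA.
Qed.

Lemma ltrace_close_r : ltrace P close_r = ltrace (tensor_pair P Q) h.
Proof.
have cap : (idm V ⊠ act_ev (ev (radj Q)) V') ∘ assoc V W (W' ⊗ V') =
   (runit V ⊠ idm V') ∘ (((idm V ⊠ ev (radj Q)) ⊠ idm V') ∘
     ((assoc V W W' ⊠ idm V') ∘ assocV (V ⊗ W) W' V')).
  rewrite -triangle -!compA (comp_cut2 (assoc_nat _ _ _)).
  rewrite (compA (assoc V (W ⊗ W') V')) pentagon_midV /act_ev -lock.
  by rewrite !whiskM_l -!compA.
have cup : assocV V W (W' ⊗ V') ∘ (idm V ⊠ act_coev (coev (ladj Q)) V') =
   assoc (V ⊗ W) W' V' ∘ ((assocV V W W' ⊠ idm V') ∘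
     (((idm V ⊠ coev (ladj Q)) ⊠ idm V') ∘ (runitV V ⊠ idm V'))).
  rewrite -triangleV -(comp_cut2 (assocV_nat _ _ _)) !compA pentagon_mid.
  by rewrite /act_coev -lock !whiskM_l -!compA.
have hW : (h ⊠ idm W') ⊠ idm V' =
   assocV (V ⊗ W) W' V' ∘ ((h ⊠ idm (W' ⊗ V')) ∘ assoc (V ⊗ W) W' V').
  by rewrite -thom1 -assoc_nat compA assocK comp1m.
rewrite /ltrace /= nested_evE nested_coevE -!compA; congr (_ ∘ _).
rewrite !compA; congr (_ ∘ _).
by rewrite cap -!compA cup /close_r /mid !whiskM_r hW -!compA.
Qed.

(** The right trace on V ⊗ W closes both strands on one side. Moving one strand
    at a time to the other side, by sphericality of W and then of V, gives the
    left trace. *)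
Lemma spherical_tensor :
  (forall f, rtrace P f = ltrace P f) -> (forall f, rtrace Q f = ltrace Q f) ->
  rtrace (tensor_pair P Q) h = ltrace (tensor_pair P Q) h.
Proof.
by move=> eP eQ; rewrite rtrace_close_l eQ ltrace_close_l eP ltrace_close_r.
Qed.

End Sphere.

(** * Rescaling and direct sums of dualities *)

Section Scaling.
Variables (K : fieldType) (C : monCat K).
Implicit Types V W : C.

(** The snake equations force the unit to be scaled by the inverse of the factor
    of the counit. *)
Definition scaled V V' (t : K) (a b : adj V V') :=
  coev b = t^-1 *: coev a /\ ev b = t *: ev a.

Lemma act_evZ V V' t (e : V ⊗ V' ~> one) Z : act_ev (t *: e) Z = t *: act_ev e Z.
Proof. by rewrite /act_ev -!lock thomZl compZr compZl. Qed.

Lemma act_coevZ V V' t (h : one ~> V' ⊗ V) Z :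
  act_coev (t *: h) Z = t *: act_coev h Z.
Proof. by rewrite /act_coev -!lock thomZl compZr compZl. Qed.

Lemma scaled_exists V V' (t : K) (a : adj V V') : t != 0 ->
  {b : adj V V' | scaled t a b}.
Proof.
move=> t0; have s1 : snake1 (t^-1 *: coev a) (t *: ev a) = idm V.
  rewrite /snake1 !(thomZr, thomZl, compZr, compZl) scalerA ?mulVf ?mulfV // scale1r.
  exact: adj_snake1.
have s2 : snake2 (t^-1 *: coev a) (t *: ev a) = idm V'.
  rewrite /snake2 !(thomZr, thomZl, compZr, compZl) scalerA ?mulVf ?mulfV // scale1r.
  exact: adj_snake2.
by exists (Adj s1 s2).
Qed.

Lemma scaled_nested V V' W W' (a a1 : adj V V') (b b1 : adj W W') s t :
  scaled s a a1 -> scaled t b b1 ->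
  scaled (s * t) (nested_adj a b) (nested_adj a1 b1).
Proof.
move=> [ca ea] [cb eb]; split=> /=.
  rewrite !nested_coevE ca cb act_coevZ !(thomZr, compZr, compZl) scalerA.
  by rewrite invfM mulrC.
by rewrite !nested_evE ea eb act_evZ !(thomZr, compZr, compZl) scalerA mulrC.
Qed.

Lemma rdagger_scaled V V' W W' (a a1 : adj V V') (b b1 : adj W W') s t (f : V ~> W) :
  scaled s a a1 -> scaled t b b1 ->
  rdagger a1 b1 f = (s^-1 * t) *: rdagger a b f.
Proof.
move=> [ca _] [_ eb]; rewrite !rdaggerE ca eb act_coevZ.
by rewrite !(thomZr, thomZl, compZr, compZl) scalerA.
Qed.

(** A direct sum of dualities is a duality, with block diagonal unit and
    counit. *)
Lemma adj_sum n V V' (Y Y' : 'I_n -> C) (b : forall k, adj (Y k) (Y' k))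
    (i : forall k, Y k ~> V) (p : forall k, V ~> Y k)
    (j : forall k, Y' k ~> V') (q : forall k, V' ~> Y' k) :
    (forall k, p k ∘ i k = idm _) -> (forall k, q k ∘ j k = idm _) ->
    (forall k l, k != l -> p k ∘ i l = 0) -> (forall k l, k != l -> q k ∘ j l = 0) ->
    \sum_k i k ∘ p k = idm V -> \sum_k j k ∘ q k = idm V' ->
  exists a : adj V V', ev a = \sum_k ev (b k) ∘ (p k ⊠ q k).
Proof.
move=> pi qj pi0 qj0 ip jq.
pose e := \sum_k ev (b k) ∘ (p k ⊠ q k).
pose h := \sum_k (j k ⊠ i k) ∘ coev (b k).
have act_e Z : act_ev e Z = \sum_k act_ev (ev (b k)) Z ∘ (p k ⊠ (q k ⊠ idm Z)).
  rewrite /act_ev -!lock /e thom_suml comp_sumr comp_suml; apply: eq_bigr => k _.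
  by have := act_ev_comp (ev (b k)) (p k) (q k) Z; rewrite /act_ev -!lock.
have act_h Z : act_coev h Z = \sum_k (j k ⊠ (i k ⊠ idm Z)) ∘ act_coev (coev (b k)) Z.
  rewrite /act_coev -!lock /h thom_suml comp_sumr comp_suml; apply: eq_bigr => k _.
  by have := act_coev_comp (coev (b k)) (i k) (j k) Z; rewrite /act_coev -!lock.
have s1 : snake1 h e = idm V.
  have -> : snake1 h e = act_ev e V ∘ (idm V ⊠ h) ∘ runitV V by rewrite /act_ev -lock.
  rewrite act_e /h thom_sumr !comp_suml -[RHS]ip; apply: eq_bigr => k _.
  (* The blocks of the counit and of the unit meet in q k ∘ j l, which
     vanishes off the diagonal. *)
  have merge l : (p k ⊠ (q k ⊠ idm V)) ∘ (idm V ⊠ ((j l ⊠ i l) ∘ coev (b l))) =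
                 p k ⊠ (((q k ∘ j l) ⊠ i l) ∘ coev (b l)).
    by rewrite -thomM compm1 compA -thomM comp1m.
  rewrite -[_ ∘ _ ∘ \sum__ _]compA comp_sumr.
  rewrite (bigD1 k) //= big1 ?addr0 => [|l lk]; rewrite merge; last first.
    by rewrite qj0 1?eq_sym // (lin0 (thom_linear_l _)) comp0l (lin0 (thom_linear_r _)).
  rewrite qj -[p k]comp1m -[_ ∘ coev _]compm1 thomM whiskM_l !compA act_ev_nat.
  rewrite -[i k ∘ _ ∘ _]compA adj_act_ev -!compA.
  by rewrite (compA (runit _)) runit_nat -!compA runitVK compm1 comp1m.
have s2 : snake2 h e = idm V'.
  have -> : snake2 h e = runit V' ∘ (idm V' ⊠ e) ∘ act_coev h V'.
    by rewrite /act_coev -lock /snake2 !compA.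
  rewrite act_h /e thom_sumr -compA !comp_suml comp_sumr -[RHS]jq; apply: eq_bigr => k _.
  have merge l : (idm V' ⊠ (ev (b k) ∘ (p k ⊠ q k))) ∘ (j l ⊠ (i l ⊠ idm V')) =
                 j l ⊠ (ev (b k) ∘ ((p k ∘ i l) ⊠ q k)).
    by rewrite -thomM comp1m -compA -thomM compm1.
  rewrite comp_sumr (bigD1 k) //= big1 ?addr0 => [|l lk]; rewrite (comp_cut (merge _)); last first.
    by rewrite pi0 1?eq_sym // (lin0 (thom_linear_l _)) comp0r (lin0 (thom_linear_r _)) comp0l.
  rewrite pi -[j k]compm1 -[ev _ ∘ _]comp1m thomM whiskM_l -!compA -act_coev_nat.
  rewrite (compA (_ ⊠ ev _)) adj_act_coev.
  by rewrite !compA runit_nat -(compA (j k)) runitVK compm1.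
by exists (Adj s1 s2).
Qed.

End Scaling.

(** * Simple objects *)

Section Simple.
Variables (K : fieldType) (C : linCat K).
Implicit Types V W : C.

Lemma simpleP V :
  simple V <-> idm V != 0 /\ forall f : V ~> V, exists c, f = c *: idm V.
Proof.
split=> [V1|[id0 sc]]; last first.
  rewrite /simple; suff -> : {: V ~> V}%VS = <[idm V]>%VS by rewrite dim_vline id0.
  apply/eqP; rewrite eqEsubv subvf andbT; apply/subvP => f _.
  by have [c ->] := sc f; rewrite memvZ ?memv_line.
have id0 : idm V != 0.
  apply/eqP => id0; suff dim0 : \dim {: V ~> V} = 0%N by move: V1; rewrite /simple dim0.
  apply/eqP; rewrite dimv_eq0 -subv0; apply/subvP => f _.
  by rewrite -(compm1 f) id0 comp0r memv0.
split=> // f; apply/vlineP.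
suff -> : <[idm V]>%VS = {: V ~> V}%VS by exact: memvf.
by apply/eqP; rewrite eqEdim subvf dim_vline id0 V1.
Qed.

Lemma simple_id V : simple V -> idm V != 0.
Proof. by move/simpleP=> []. Qed.

Lemma simple_scalar V : simple V -> forall f : V ~> V, exists c, f = c *: idm V.
Proof. by move/simpleP=> []. Qed.

End Simple.

Section Semisimplicity.
Variables (K : fieldType) (C : linCat K).
Hypothesis ss : semisimple C.
Implicit Types V W : C.

(** Schur's lemma: semisimplicity only provides it for non-isomorphic objects, and
    an isomorphism turns f into an endomorphism, that is, a scalar. *)
Lemma simple_iso V W (f : V ~> W) : simple V -> simple W -> f != 0 ->
  exists g : W ~> V, g ∘ f = idm V /\ f ∘ g = idm W.
Proof.
move=> sV sW f0; case: ss => _ _ schur.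
have [[f1 [g1 [gf fg]]]|noniso] := pselect (isomorphic V W); last first.
  by rewrite (schur _ _ sV sW noniso f) eqxx in f0.
have [c E] := simple_scalar sV (g1 ∘ f).
have fE : f = c *: f1 by rewrite -[f]comp1m -fg -compA E compZr compm1.
have c0 : c != 0 by apply: contraNneq f0 => c0; rewrite fE c0 scale0r.
exists (c^-1 *: g1).
by rewrite fE !(compZl, compZr) gf fg !scalerA ?mulVf ?mulfV // !scale1r.
Qed.

Lemma simple_split V W (f : V ~> W) : simple V -> f != 0 ->
  exists r : W ~> V, r ∘ f = idm V.
Proof.
move=> sV f0; case: ss => _ dec _.
have [n [Y [sY [i [p [pi pi0 ip]]]]]] := dec W.
have [k pf0] : exists k, p k ∘ f != 0.
  apply: contrapT => /forallNP all0; case/eqP: f0.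
  rewrite -[f]comp1m -ip comp_suml big1 // => k _; rewrite -compA.
  by have /negP/negPn/eqP -> := all0 k; rewrite comp0r.
have [g [gpf _]] := simple_iso sV (sY k) pf0.
by exists (g ∘ p k); rewrite -compA.
Qed.

Lemma simple_section V W (f : W ~> V) : simple V -> f != 0 ->
  exists s : V ~> W, f ∘ s = idm V.
Proof.
move=> sV f0; case: ss => _ dec _.
have [n [Y [sY [i [p [pi pi0 ip]]]]]] := dec W.
have [k fi0] : exists k, f ∘ i k != 0.
  apply: contrapT => /forallNP all0; case/eqP: f0.
  rewrite -[f]compm1 -ip comp_sumr big1 // => k _; rewrite compA.
  by have /negP/negPn/eqP -> := all0 k; rewrite comp0l.
have [g [_ fig]] := simple_iso (sY k) sV fi0.
by exists (i k ∘ g); rewrite compA.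
Qed.

End Semisimplicity.

Section SimpleDual.
Variables (K : fieldType) (C : monCat K).
Implicit Types V W : C.

(** Transposition identifies End(V) with End(V'). *)
Lemma simple_dual V V' (a : adj V V') : simple V -> simple V'.
Proof.
move=> sV; apply/simpleP; split=> [|f].
  apply: contra_neq (simple_id sV) => id0.
  by apply: (rdagger_eq0 (a := a) (b := a)); rewrite rdagger_id.
have [c E] := simple_scalar sV (ldagger a a f).
exists c; rewrite -(rdagger_ldagger a a f) E.
by rewrite (linZ (rdagger_linear a a)) rdagger_id.
Qed.

End SimpleDual.

Section UnitTrace.
Variables (K : fieldType) (C : fusionCat K).

Lemma scalE (f : (one : C) ~> one) : f = scal f *: idm one.
Proof.
have mem_f : f \in <<[tuple idm (one : C)]>>%VS.
  by have [c ->] := simple_scalar (fus_unit C) f; rewrite span_seq1 memvZ ?memv_line.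
by rewrite {1}(coord_span mem_f) big_ord1.
Qed.

Lemma scalZ c (f : (one : C) ~> one) : scal (c *: f) = c * scal f.
Proof. by rewrite /scal linearZ. Qed.

Lemma scal_inj (f g : (one : C) ~> one) : scal f = scal g -> f = g.
Proof. by move=> E; rewrite (scalE f) (scalE g) E. Qed.

Lemma scal_eq0 (f : (one : C) ~> one) : (scal f == 0) = (f == 0).
Proof.
by rewrite [in RHS](scalE f) scaler_eq0 (negPf (simple_id (fus_unit C))) orbF.
Qed.

(** Bending the strand V' identifies Hom(V' ⊗ W, 1) with Hom(W, V). *)
Lemma factor_ev V V' W (b : adj V' V) (r : V' ⊗ W ~> (one : C)) :
  exists f : W ~> V, r = ev b ∘ (idm V' ⊠ f).
Proof.
exists (runit V ∘ (idm V ⊠ r) ∘ act_coev (coev b) W).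
by rewrite !whiskM_l !compA -act_ev_one act_ev_nat -compA act_adj1 compm1.
Qed.

(** The unit of the duality a is a nonzero map from a simple object, so it has a
    retraction; by [factor_ev] and Schur's lemma the retraction is a multiple of
    the counit of b. *)
Lemma ev_coev_neq0 (V V' : C) (a : adj V V') (b : adj V' V) : simple V ->
  ev b ∘ coev a != 0.
Proof.
move=> sV.
have coev0 : coev a != 0.
  apply: contra_neq (simple_id sV) => c0; have := adj_act_ev a.
  rewrite c0 (lin0 (thom_linear_r _)) comp0r => r0.
  by rewrite -(runitVK V) -r0 comp0l.
have [r rc] := simple_split (fus_semisimple C) (fus_unit C) coev0.
have [f rE] := factor_ev b r.
have [c fE] := simple_scalar sV f.
apply: contra_neq (simple_id (fus_unit C)) => bc0.
by rewrite -rc rE fE thomZr thom1 compZr compm1 compZl bc0 scaler0.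
Qed.

Lemma rtrace_neq0 (V : C) (P : dualPair V) : simple V -> rtrace P (idm V) != 0.
Proof. by move=> sV; rewrite /rtrace thom1 compm1 ev_coev_neq0. Qed.

(** Hom(V, W) is a line, so [ddual] acts on it by a scalar, and the cyclicity of
    the trace identifies the scalar as the ratio of the dimensions. *)
Lemma ddual_simple (V W : C) (P : dualPair V) (Q : dualPair W) (f : V ~> W) :
    simple V -> simple W -> f != 0 ->
  exists c, ddual P Q f = c *: f /\ rtrace P (idm V) = c *: rtrace Q (idm W).
Proof.
move=> sV sW f0.
have [g [gf fg]] := simple_iso (fus_semisimple C) sV sW f0.
have [c E] := simple_scalar sV (g ∘ ddual P Q f).
have f_c : ddual P Q f = c *: f.
  by rewrite -[LHS]comp1m -fg -compA E compZr compm1.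
by exists c; split=> //; rewrite -gf (rtrace_cyclic g f_c) fg.
Qed.

(** Dualities of isomorphic simple objects with equal dimensions are
    indistinguishable; this is the independence of the chosen duals and
    partners. *)
Lemma ddual_balanced (V W : C) (P : dualPair V) (Q : dualPair W) (f : V ~> W) :
    simple V -> simple W -> rtrace P (idm V) = rtrace Q (idm W) ->
  ddual P Q f = f.
Proof.
move=> sV sW PQ; have [->|f0] := eqVneq f 0; first exact: ddual0.
have [c [-> tr]] := ddual_simple P Q sV sW f0.
suff -> : c = 1 by rewrite scale1r.
have := rtrace_neq0 Q sW; rewrite -scal_eq0 => Q0.
by apply: (mulIf Q0); rewrite -scalZ -tr PQ mul1r.
Qed.

(** The factor is the scalar by which the transpose of the identity, from one
    duality to the other, acts. *)
Lemma scaled_simple (V V' : C) (b b1 : adj V' V) : simple V ->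
  exists2 t, t != 0 & scaled t b b1.
Proof.
move=> sV; have [t E] := simple_scalar sV (rdagger b b1 (idm V')).
have evE : ev b1 = t *: ev b.
  have := ev_rdagger b b1 (idm V').
  by rewrite E thomZr compZr !thom1 !compm1.
have coevE : coev b = t *: coev b1.
  have := coev_rdagger b b1 (idm V').
  by rewrite E thomZl compZl !thom1 !comp1m.
have t0 : t != 0.
  apply: contra_neq (simple_id sV) => t0; have := adj_act_coev b1.
  rewrite evE t0 scale0r (lin0 (thom_linear_r _)) comp0l => r0.
  by rewrite -(runitVK V) -r0 comp0r.
by exists t => //; split=> //; rewrite coevE scalerA mulVf // scale1r.
Qed.

End UnitTrace.

(** * Representatives of the simple objects *)

Section Reps.
Variables (K : fieldType) (C : fusionCat K) (X : simpleReps C).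
Implicit Types (V W : C) (i j : idx X).

Lemma rep_decomp V :
  exists n (l : 'I_n -> idx X), is_direct_sum (fun k => X (l k)) V.
Proof.
have [_ dec _] := fus_semisimple C.
have [n [Y [sY [inj [prj [pi pi0 ip]]]]]] := dec V.
have rep (k : 'I_n) : {i : idx X & {f : Y k ~> X i & {g | g ∘ f = idm _ /\ f ∘ g = idm _}}}.
  have [i /cid[f /cid gP]] := cid (rep_surj X (sY k)).
  by exists i, f.
exists n, (fun k => projT1 (rep k)).
pose f k := projT1 (projT2 (rep k)); pose g k := sval (projT2 (projT2 (rep k))).
have gf k : g k ∘ f k = idm _ by have [] := svalP (projT2 (projT2 (rep k))).
have fg k : f k ∘ g k = idm _ by have [] := svalP (projT2 (projT2 (rep k))).
exists (fun k => inj k ∘ g k), (fun k => f k ∘ prj k); split=> [k|k l kl|].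
- by rewrite -!compA (comp_cut (pi k)) comp1m fg.
- by rewrite -!compA (comp_cut (pi0 k l kl)) comp0l comp0r.
- by rewrite -ip; apply: eq_bigr => k _; rewrite -!compA (comp_cut (gf k)) comp1m.
Qed.

Lemma rep_epi V W (g g' : V ~> W) :
  (forall i (f : X i ~> V), g ∘ f = g' ∘ f) -> g = g'.
Proof.
move=> E; have [n [l [inj [prj [_ _ ip]]]]] := rep_decomp V.
rewrite -[g]compm1 -[g']compm1 -ip !comp_sumr; apply: eq_bigr => k _.
by rewrite !compA E.
Qed.

Lemma rep_hom_neq0 i j (f : X i ~> X j) : f != 0 -> i = j.
Proof.
move=> f0; have [g gf] := simple_iso (fus_semisimple C) (rep_simple i) (rep_simple j) f0.
by apply: rep_inj; exists f, g.
Qed.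

Lemma rep_unit_iso :
  exists (u : X (idx0 X) ~> one) (v : one ~> X (idx0 X)),
    v ∘ u = idm _ /\ u ∘ v = idm _.
Proof. exact: rep_idx0. Qed.

(** The unit object is its own dual, and transposing an isomorphism from the
    representative to the unit object identifies the dual of the representative
    with it as well. *)
Lemma star_idx0 : star X (idx0 X) = idx0 X.
Proof.
have [u [v [vu uv]]] := rep_unit_iso; have [a] := rep_star (idx0 X).
apply: rep_inj.
exists (v ∘ rdagger (one_adj C) a v), (rdagger a (one_adj C) u ∘ u); split.
  rewrite -compA (compA u) uv comp1m -(rdagger_comp _ (one_adj C)) vu.
  exact: rdagger_id.
by rewrite -compA (compA (rdagger _ _ v)) -rdagger_comp uv rdagger_id comp1m.
Qed.

Lemma fusion_coef_neq0 i j k :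
  fusion_coef i j k != 0%N <-> exists v : X i ~> X j ⊗ X k, v != 0.
Proof.
rewrite /fusion_coef; split=> [N0|[v v0]].
  by exists (vpick {: X i ~> X j ⊗ X k}%VS); rewrite vpick0 -dimv_eq0.
rewrite dimv_eq0; apply: contraNneq v0 => E; rewrite -memv0 -E.
exact: memvf.
Qed.

End Reps.

(** * Balanced dualities *)

Section Balanced.
Variables (K : fieldType) (C : fusionCat K) (X : simpleReps C).
Variables (d : idx X -> K) (hd : root_choice d) (D : dualChoice d).
Implicit Types (V W : C) (i j k : idx X).

Definition rep_pair i : dualPair (X i) := DualPair (dadj D i) (padj D i).

Lemma involution_opE i j k (v : X i ~> X j ⊗ X k) :
  involution_op D v =
  ddual (rep_pair i) (tensor_pair (rep_pair j) (rep_pair k)) v.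
Proof. by []. Qed.

Lemma rtrace_swap V (P : dualPair V) :
  rtrace (swap_pair P) (idm _) = ltrace P (idm V).
Proof. by rewrite /rtrace /ltrace !thom1. Qed.

Lemma rtrace_rep i : scal (rtrace (rep_pair i) (idm _)) = d i.
Proof. by rewrite /rtrace thom1 compm1; apply: padjP. Qed.

Lemma root_neq0 i : d i != 0.
Proof. by rewrite -rtrace_rep scal_eq0 rtrace_neq0 //; apply: rep_simple. Qed.

(** The square of the root is the product of the two traces, so both of them are
    equal to the root. *)
Lemma ltrace_rep i : scal (ltrace (rep_pair i) (idm _)) = d i.
Proof.
apply: (mulfI (root_neq0 i)); rewrite -{1}rtrace_rep -expr2 (hd.1 i _ (dadj D i) (padj D i)).
by rewrite /rtrace /ltrace !thom1 !compm1.
Qed.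

Lemma spherical_rep i f : rtrace (rep_pair i) f = ltrace (rep_pair i) f.
Proof.
have [c ->] := simple_scalar (rep_simple i) f.
rewrite rtraceZ ltraceZ; congr (_ *: _); apply: scal_inj.
by rewrite rtrace_rep ltrace_rep.
Qed.

(** With p a retraction of v, the right trace of p v = id is c times that of v p,
    and the left trace of v p is c times that of p v. The right and left traces
    agree on both sides, so d_i = c^2 d_i. *)
Lemma ddual_sqr i j k (v : X i ~> X j ⊗ X k) c : v != 0 ->
  ddual (rep_pair i) (tensor_pair (rep_pair j) (rep_pair k)) v = c *: v ->
  c ^+ 2 = 1.
Proof.
move=> v0 v_c.
have [p pv] := simple_split (fus_semisimple C) (rep_simple i) v0.
have := rtrace_cyclic p v_c; have := ltrace_cyclic p v_c.
rewrite (spherical_tensor _ (@spherical_rep j) (@spherical_rep k)) => <-.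
rewrite pv scalerA => /(congr1 (@scal _ _)); rewrite scalZ rtrace_rep ltrace_rep.
by move=> E; apply: (mulIf (root_neq0 i)); rewrite mul1r expr2.
Qed.

Definition balanced_iso V W (P : dualPair V) (Q : dualPair W) :=
  exists (f : V ~> W) (g : W ~> V), [/\ g ∘ f = idm V, f ∘ g = idm W,
    ddual P Q f = f & ddual Q P g = g].

Lemma balanced_iso_refl V (P : dualPair V) : balanced_iso P P.
Proof. by exists (idm V), (idm V); rewrite !comp1m ddual_id. Qed.

(** The dual chosen for X_i is isomorphic to X_i*, and the dimensions agree since
    the root choice is invariant under duality. *)
Lemma balanced_iso_star i : balanced_iso (swap_pair (rep_pair i)) (rep_pair (star X i)).
Proof.
have [a] := rep_star i.
exists (rdagger a (dadj D i) (idm _)), (rdagger (dadj D i) a (idm _)).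
have tr : rtrace (swap_pair (rep_pair i)) (idm _) = rtrace (rep_pair (star X i)) (idm _).
  by apply: scal_inj; rewrite rtrace_swap ltrace_rep rtrace_rep hd.2.
have s' := simple_dual (dadj D i) (rep_simple i).
have s1 := rep_simple (star X i).
by rewrite -!rdagger_comp !comp1m !rdagger_id !ddual_balanced.
Qed.

(** The involution operators can be computed on any balanced model of the simple
    objects. *)
Lemma transport_hom i j k (V W Z : C) (P : dualPair V) (Q : dualPair W)
    (S : dualPair Z) (u : V ~> W ⊗ Z) c :
    balanced_iso P (rep_pair i) -> balanced_iso Q (rep_pair j) ->
    balanced_iso S (rep_pair k) ->
    u != 0 -> ddual P (tensor_pair Q S) u = c *: u ->
  exists2 v : X i ~> X j ⊗ X k, v != 0 &
    ddual (rep_pair i) (tensor_pair (rep_pair j) (rep_pair k)) v = c *: v.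
Proof.
move=> [f [f' [f'f _ ddf ddf']]] [g [g' [g'g _ ddg _]]] [h [h' [h'h _ ddh _]]] u0 u_c.
exists ((g ⊠ h) ∘ u ∘ f').
  apply: contra_neq u0 => v0.
  have : (g' ⊠ h') ∘ ((g ⊠ h) ∘ u ∘ f') ∘ f = 0 by rewrite v0 comp0r comp0l.
  by rewrite -!compA f'f compm1 (comp_cut (esym (thomM _ _ _ _))) g'g h'h thom1 comp1m.
rewrite (ddual_comp _ P) (ddual_comp _ (tensor_pair Q S)) ddual_tensor.
by rewrite ddf' ddg ddh u_c compZr compZl.
Qed.

(** Maps in the opposite direction are detected by composing them with the maps
    V -> W, where the composites are scalars, and these are fixed by [ddual]. *)
Lemma ddual_reverse V W (P : dualPair V) (Q : dualPair W) c : simple V ->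
    (forall v : V ~> W, ddual P Q v = c *: v) ->
  forall p : W ~> V, c *: ddual Q P p = p.
Proof.
move=> sV all_c p; apply/eqP; rewrite -subr_eq0; apply: contraT => q0.
have [s qs] := simple_section (fus_semisimple C) sV q0.
case/eqP: (simple_id sV); rewrite -qs.
have [b E] := simple_scalar sV (p ∘ s).
have E2 : ddual Q P p ∘ (c *: s) = p ∘ s.
  by rewrite -all_c -ddual_comp E ddualZ ddual_id.
by rewrite -scaleN1r addrC (comp_linear_l s) (compZl c) -(compZr (ddual Q P p)) E2 scaleN1r addNr.
Qed.

Lemma ddual_coev V (P : dualPair V) :
  ddual (one_pair C) (tensor_pair P (swap_pair P)) (coev (ladj P)) = coev (ladj P).
Proof. by rewrite /ddual /= rdagger_coev rdagger_ev. Qed.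

Lemma rtrace_one : rtrace (one_pair C) (idm one) = idm one.
Proof. by rewrite /rtrace thom1 compm1 /= lunitVK. Qed.

Lemma scal_id : scal (idm (one : C)) = 1.
Proof.
apply/eqP; have /eqP := scalE (idm (one : C)).
rewrite -{1}[idm one]scale1r -subr_eq0 -scalerBl scaler_eq0 (negPf (simple_id (fus_unit C))).
by rewrite orbF subr_eq0 eq_sym.
Qed.

(** The scalar is d_0 because the unit object with its trivial self-duality has
    dimension 1. *)
Lemma ddual_unit_rep (u : X (idx0 X) ~> one) :
  ddual (rep_pair (idx0 X)) (one_pair C) u = d (idx0 X) *: u.
Proof.
have [->|u0] := eqVneq u 0; first by rewrite ddual0 scaler0.
have [c [-> tr]] := ddual_simple (rep_pair _) (one_pair C) (rep_simple _) (fus_unit C) u0.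
by rewrite -rtrace_rep tr rtrace_one scalZ scal_id mulr1.
Qed.

(** Up to balanced isomorphisms, v is the unit 1 -> X_i ⊗ X_i', which [ddual]
    fixes, so the scalar comes only from the identification of X_0 with 1. *)
Lemma hom_unit_rep i :
  exists2 v : X (idx0 X) ~> X i ⊗ X (star X i), v != 0 &
    ddual (rep_pair _) (tensor_pair (rep_pair i) (rep_pair (star X i))) v =
    d (idx0 X) *: v.
Proof.
have [u [u' [u'u uu']]] := rep_unit_iso X.
apply: (@transport_hom _ _ _ _ _ _ (rep_pair (idx0 X)) (rep_pair i)
  (swap_pair (rep_pair i)) (coev (padj D i) ∘ u)).
- exact: balanced_iso_refl.
- exact: balanced_iso_refl.
- exact: balanced_iso_star.
- apply: contra_neq (ev_coev_neq0 (padj D i) (dadj D i) (simple_dual (dadj D i) (rep_simple i))).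
  by move=> cu0; rewrite -[coev _]compm1 -uu' (compA (coev _)) cu0 comp0l comp0r.
- rewrite (ddual_comp _ (one_pair C)) ddual_unit_rep compZr.
  by rewrite (ddual_coev (rep_pair i)).
Qed.

Section Symbols.
Variable eps : idx X -> idx X -> idx X -> K.
Hypothesis eps_sign : forall i j k, is_sign (eps i j k).
Hypothesis epsP : forall i j k (v : X i ~> X j ⊗ X k),
  ddual (rep_pair i) (tensor_pair (rep_pair j) (rep_pair k)) v = eps i j k *: v.

Lemma eps_uniq i j k c (v : X i ~> X j ⊗ X k) : v != 0 ->
  ddual (rep_pair i) (tensor_pair (rep_pair j) (rep_pair k)) v = c *: v ->
  eps i j k = c.
Proof.
move=> v0; rewrite epsP => /eqP; rewrite -subr_eq0 -scalerBl scaler_eq0 (negPf v0) orbF.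
by rewrite subr_eq0 => /eqP.
Qed.

Lemma eps_unit i : eps (idx0 X) i (star X i) = d (idx0 X).
Proof. by have [v v0 v_c] := hom_unit_rep i; apply: eps_uniq v_c. Qed.

Lemma eps_neq0 i j k : eps i j k != 0.
Proof. by case: (eps_sign i j k) => ->; rewrite ?oppr_eq0 oner_neq0. Qed.

Lemma eps_inv i j k : (eps i j k)^-1 = eps i j k.
Proof. by case: (eps_sign i j k) => ->; rewrite ?invrN invr1. Qed.

(** Maps X_j ⊗ X_k -> X_i have the inverse sign of the maps in the opposite
    direction, hence the same sign; their transposes are the maps
    X_i* -> X_k* ⊗ X_j*. *)
Lemma eps_dual i j k : fusion_coef i j k != 0%N ->
  eps i j k = eps (star X i) (star X k) (star X j).
Proof.
move/fusion_coef_neq0 => [v v0].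
have [p pv] := simple_split (fus_semisimple C) (rep_simple i) v0.
have p_c := ddual_reverse (rep_simple i) (@epsP i j k) p.
have [u u0 u_c] : exists2 u : X (star X i) ~> X (star X k) ⊗ X (star X j), u != 0 &
    ddual (rep_pair _) (tensor_pair (rep_pair _) (rep_pair _)) u = eps i j k *: u.
  apply: (transport_hom (balanced_iso_star i) (balanced_iso_star k) (balanced_iso_star j)
    (u := rdagger (nested_adj (dadj D j) (dadj D k)) (dadj D i) p)).
    apply: contra_neq v0 => /rdagger_eq0 p0.
    by case/eqP: (simple_id (rep_simple i)); rewrite -pv p0 comp0l.
  rewrite -(linZ (rdagger_linear _ _)).
  have <- : ddual (tensor_pair (rep_pair j) (rep_pair k)) (rep_pair i) p = eps i j k *: p.
    by rewrite -[in RHS]p_c scalerA -{1}eps_inv mulVf ?eps_neq0 // scale1r.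
  exact: (ddual_swap (tensor_pair (rep_pair j) (rep_pair k)) (rep_pair i) p).
by rewrite (eps_uniq u0 u_c).
Qed.

(** Bending X_j down turns v into a map z : X_j' ⊗ X_i -> X_k with the same sign,
    as the counit is fixed by [ddual]; the transpose of z is a map
    X_k' -> X_i' ⊗ X_j. *)
Lemma eps_rot i j k : fusion_coef i j k != 0%N ->
  eps i j k = eps (star X k) (star X i) j.
Proof.
move/fusion_coef_neq0 => [v v0].
pose b := padj D j.
pose z := act_ev (ev b) (X k) ∘ (idm _ ⊠ v).
pose Pj := swap_pair (rep_pair j).
have z_c : ddual (tensor_pair Pj (rep_pair i)) (rep_pair k) z = eps i j k *: z.
  rewrite /z (ddual_comp _ (tensor_pair Pj (tensor_pair (rep_pair j) (rep_pair k)))).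
  rewrite (ddual_act_ev Pj (rep_pair k)) ddual_tensor ddual_id epsP.
  by rewrite thomZr compZr.
have [u u0 u_c] : exists2 u : X (star X k) ~> X (star X i) ⊗ X j, u != 0 &
    ddual (rep_pair _) (tensor_pair (rep_pair _) (rep_pair _)) u = eps i j k *: u.
  apply: (transport_hom (balanced_iso_star k) (balanced_iso_star i)
    (balanced_iso_refl (rep_pair j))
    (u := rdagger (nested_adj b (dadj D i)) (dadj D k) z)).
    apply: contra_neq v0 => /rdagger_eq0 z0.
    (* Bending back recovers v from z. *)
    rewrite -[v]comp1m -(act_adj2 b) -compA act_coev_nat compA -whiskM_l -/z z0.
    by rewrite (lin0 (thom_linear_r _)) comp0l.
  rewrite -(linZ (rdagger_linear _ _)) -z_c.
  exact: (ddual_swap (tensor_pair Pj (rep_pair i)) (rep_pair k) z).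
by rewrite (eps_uniq u0 u_c).
Qed.

End Symbols.
End Balanced.

(** * From even-handed structures to twisted automorphisms *)

Section FromEvenHanded.
Variables (K : fieldType) (C : fusionCat K) (X : simpleReps C).
Variables (d : idx X -> K) (hd : root_choice d) (D : dualChoice d).
Variable Psi : evenHanded C.
Implicit Types (V W : C) (i j : idx X).

Definition eh_pair V V' (a : adj V V') : dualPair V := DualPair a (Psi _ _ a).

Lemma eh_ddual V V' W W' (a : adj V V') (b : adj W W') (f : V ~> W) :
  ddual (eh_pair a) (eh_pair b) f = f.
Proof. by rewrite /ddual /= (eh_dagger Psi a b) rdagger_ldagger. Qed.

(** The scalar is the same for all the dualities and partners: by the cyclicity
    of the trace, the dimension t d_i of X_i under Psi does not depend on the
    duality. *)
Lemma eh_scalar i : exists2 t : K, t != 0 &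
  forall V' (a : adj (X i) V') (b : adj V' (X i)), partner d a b -> scaled t b (Psi _ _ a).
Proof.
have [t t0 tP] := scaled_simple (padj D i) (Psi _ _ (dadj D i)) (rep_simple i).
exists t => // V' a b ab.
have [s s0 sP] := scaled_simple b (Psi _ _ a) (rep_simple i).
suff <- : s = t by [].
apply: (mulIf (root_neq0 D i)).
have := rtrace_cyclic (P := eh_pair a) (Q := eh_pair (dadj D i)) (idm (X i))
  (f := idm (X i)) (c := 1).
rewrite eh_ddual scale1r => /(_ erefl); rewrite !comp1m scale1r.
move/(congr1 (@scal _ _)); rewrite /rtrace !thom1 !compm1 /=.
by rewrite sP.2 tP.2 !compZl !scalZ ab (padjP D i).
Qed.

(** [ddual] is the identity for the duals (a, Psi a), and passing to the partners
    rescales the left duals. *)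
Lemma scaled_ddual_rep t i j k (v : X i ~> X j ⊗ X k) :
    (forall i, scaled (t i) (padj D i) (Psi _ _ (dadj D i))) -> (forall i, t i != 0) ->
  ddual (rep_pair D i) (tensor_pair (rep_pair D j) (rep_pair D k)) v =
  (t j * t k / t i) *: v.
Proof.
move=> tP t0.
have := eh_ddual (dadj D i) (nested_adj (dadj D j) (dadj D k)) v.
rewrite /ddual /= (eh_tensor Psi) (rdagger_scaled _ (scaled_nested (tP k) (tP j)) (tP i)).
move=> E; rewrite -[in RHS]E scalerA mulrACA (mulrC (t j)).
by rewrite mulfV ?mulf_neq0 // mul1r mulVf // scale1r.
Qed.

End FromEvenHanded.

(** * From twisted automorphisms to even-handed structures *)

Section ToEvenHanded.
Variables (K : fieldType) (C : fusionCat K) (X : simpleReps C).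
Variables (d : idx X -> K) (hd : root_choice d) (D : dualChoice d).
Variable eps : idx X -> idx X -> idx X -> K.
Hypothesis eps_sign : forall i j k, is_sign (eps i j k).
Hypothesis epsP : forall i j k (v : X i ~> X j ⊗ X k),
  ddual (rep_pair D i) (tensor_pair (rep_pair D j) (rep_pair D k)) v = eps i j k *: v.
Variables (t : idx X -> K) (t_neq0 : forall i, t i != 0).
Hypothesis t_twist : forall i j k, fusion_coef i j k != 0%N -> t j * t k = eps i j k * t i.
Implicit Types (V W : C) (i j : idx X).

Lemma hom_unit_coef i : fusion_coef (idx0 X) i (star X i) != 0%N.
Proof.
by have [v v0 _] := hom_unit_rep hd D i; apply/fusion_coef_neq0; exists v.
Qed.

Lemma twist_unit : t (idx0 X) = d (idx0 X).
Proof.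
apply: (mulIf (t_neq0 (idx0 X))).
have := t_twist (hom_unit_coef (idx0 X)).
by rewrite (eps_unit hd epsP) star_idx0.
Qed.

Lemma root_unit_sqr : d (idx0 X) * d (idx0 X) = 1.
Proof.
rewrite -[in X in X * _](eps_unit hd epsP (idx0 X)) -(eps_unit hd epsP (idx0 X)).
by rewrite -{1}(eps_inv eps_sign) mulVf // (eps_neq0 eps_sign).
Qed.

(** The twisting condition for X_0 in X_i ⊗ X_i*, where the sign is d_0 and t_0 is
    d_0 as well. *)
Lemma twist_star i : t i * t (star X i) = 1.
Proof.
by rewrite (t_twist (hom_unit_coef i)) (eps_unit hd epsP) twist_unit root_unit_sqr.
Qed.

Definition twist_ladj i : adj (dobj D i) (X i) := sval (scaled_exists (padj D i) (t_neq0 i)).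

Lemma twist_ladjP i : scaled (t i) (padj D i) (twist_ladj i).
Proof. exact: svalP (scaled_exists _ _). Qed.

Definition twist_pair i : dualPair (X i) := DualPair (dadj D i) (twist_ladj i).

(** The dagger axiom restricted to the maps out of simple objects, which is enough
    to determine b. *)
Definition compat V V' (a : adj V V') (b : adj V' V) :=
  forall i (f : X i ~> V), ddual (twist_pair i) (DualPair a b) f = f.

(** Compatibility determines the counit of b on V' ⊗ X_i along every map X_i -> V,
    and these maps cover V. *)
Lemma compat_uniq V V' (a : adj V V') (b b' : adj V' V) :
  compat a b -> compat a b' -> b = b'.
Proof.
move=> ab ab'; apply: adj_ext.
have [n [l [inj [prj [_ _ ip]]]]] := rep_decomp X V.
rewrite -[ev b]compm1 -[ev b']compm1 -thom1 -ip thom_sumr !comp_sumr.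
apply: eq_bigr => k _; rewrite whiskM_l !compA; congr (_ ∘ _).
rewrite -[in LHS](ab _ (inj k)) -[in RHS](ab' _ (inj k)).
rewrite (ev_ddual (twist_pair (l k)) (DualPair a b)).
by rewrite (ev_ddual (twist_pair (l k)) (DualPair a b')).
Qed.

Lemma compat_ddual V V' W W' (a : adj V V') (a' : adj V' V) (b : adj W W') (b' : adj W' W)
    (f : V ~> W) : compat a a' -> compat b b' ->
  ddual (DualPair a a') (DualPair b b') f = f.
Proof.
move=> aa' bb'; apply: (rep_epi (X := X)) => i g.
by rewrite -{1}(aa' i g) -ddual_comp bb'.
Qed.

Lemma ddual_twist_pair i j (f : X i ~> X j) : ddual (twist_pair i) (twist_pair j) f = f.
Proof.
have [->|f0] := eqVneq f 0; first exact: ddual0.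
have ij := rep_hom_neq0 f0; move: f f0; rewrite -ij => f _.
by have [c ->] := simple_scalar (rep_simple i) f; rewrite ddualZ ddual_id.
Qed.

(** The left dual is the direct sum of those of the simple summands of V, where
    V' is decomposed by the transposes of the inclusions and projections. *)
Lemma compat_exists V V' (a : adj V V') : exists b, compat a b.
Proof.
have [n [l [inj [prj [pi pi0 ip]]]]] := rep_decomp X V.
pose Ri k := rdagger (dadj D (l k)) a (inj k).
pose Rp k := rdagger a (dadj D (l k)) (prj k).
have [|||b bE] := adj_sum (fun k => twist_ladj (l k)) (p := Ri) (i := Rp)
  (j := inj) (q := prj) _ pi _ pi0 _ ip.
- by move=> k; rewrite /Ri /Rp -rdagger_comp pi rdagger_id.
- by move=> k m km; rewrite /Ri /Rp -rdagger_comp pi0 1?eq_sym // (lin0 (rdagger_linear _ _)).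
- rewrite -(rdagger_id a) -ip (lin_sum (rdagger_linear a a)).
  by apply: eq_bigr => k _; rewrite /Ri /Rp -rdagger_comp.
exists b => i f; apply: rdagger_uniq => /=.
rewrite bE comp_suml.
have -> : rdagger (dadj D i) a f =
    \sum_k rdagger (dadj D i) (dadj D (l k)) (prj k ∘ f) ∘ Ri k.
  rewrite -[f in LHS]comp1m -ip comp_suml (lin_sum (rdagger_linear _ _)).
  by apply: eq_bigr => k _; rewrite -compA (rdagger_comp _ (dadj D (l k))).
rewrite thom_suml comp_sumr; apply: eq_bigr => k _.
rewrite whiskM_r compA -(ev_ddual (twist_pair i) (twist_pair (l k))) ddual_twist_pair.
by rewrite -!compA -!thomM !comp1m !compm1.
Qed.

Lemma compat_rep i : compat (dadj D i) (twist_ladj i).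
Proof. by move=> j f; apply: ddual_twist_pair. Qed.

(** On the dual of X_i the left duality is rescaled by t_i, and on X_i* by t_i*;
    the two factors cancel by [twist_star]. *)
Lemma compat_rep_swap i : compat (twist_ladj i) (dadj D i).
Proof.
move=> j f; have [->|f0] := eqVneq f 0; first exact: ddual0.
have [g [g' [g'g _ _ _]]] := balanced_iso_star hd D i.
have ji : j = star X i.
  apply: (rep_hom_neq0 (f := g ∘ f)); apply: contra_neq f0 => gf0.
  by rewrite -[f]comp1m -g'g -compA gf0 comp0r.
have one_scaled V V' (a : adj V V') : scaled 1 a a by rewrite /scaled invr1 !scale1r.
rewrite /ddual /= (rdagger_scaled _ (one_scaled _ _ _) (twist_ladjP i)).
rewrite (linZ (rdagger_linear _ _)) (rdagger_scaled _ (one_scaled _ _ _) (twist_ladjP j)).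
have tij : t i * t j = 1 by rewrite ji twist_star.
rewrite scalerA invr1 !mul1r tij scale1r.
apply: (ddual_balanced (P := rep_pair D j) (Q := swap_pair (rep_pair D i))).
- exact: rep_simple.
- exact: simple_dual (dadj D i) (rep_simple i).
- by apply: scal_inj; rewrite rtrace_swap ltrace_rep // rtrace_rep ji -hd.2.
Qed.

(** Any map X_i -> V' decomposes over the duals of the simple summands of V. The
    inclusions of these duals are transposes of the projections of V, so [ddual]
    fixes them. *)
Lemma compat_swap V V' (a : adj V V') (b : adj V' V) : compat a b -> compat b a.
Proof.
move=> ab i f.
have [n [l [inj [prj [pi pi0 ip]]]]] := rep_decomp X V.
pose Ri k := rdagger (dadj D (l k)) a (inj k).
pose Rp k := rdagger a (dadj D (l k)) (prj k).
have RpE k : ddual (swap_pair (twist_pair (l k))) (DualPair b a) (Rp k) = Rp k.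
  by rewrite (ddual_swap (DualPair a b) (twist_pair (l k))) /= compat_ddual //; apply: compat_rep.
have -> : f = \sum_k Rp k ∘ (Ri k ∘ f).
  rewrite -[LHS]comp1m -(rdagger_id a) -ip (lin_sum (rdagger_linear a a)) comp_suml.
  by apply: eq_bigr => k _; rewrite (rdagger_comp _ (dadj D (l k))) -compA.
rewrite ddual_sum; apply: eq_bigr => k _.
by rewrite (ddual_comp _ (swap_pair (twist_pair (l k)))) RpE compat_rep_swap.
Qed.

(** Decomposing V and W reduces this to maps X_i -> X_j ⊗ X_k, on which rescaling
    by t cancels the sign. *)
Lemma compat_tensor V V' W W' (a : adj V V') (a' : adj V' V) (b : adj W W') (b' : adj W' W) :
  compat a a' -> compat b b' -> compat (nested_adj a b) (nested_adj b' a').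
Proof.
move=> aa' bb' i f.
have [n [l [inj [prj [_ _ ip]]]]] := rep_decomp X V.
have [m [r [jnj [qrj [_ _ jq]]]]] := rep_decomp X W.
have -> : f = \sum_k \sum_h (inj k ⊠ jnj h) ∘ ((prj k ⊠ qrj h) ∘ f).
  rewrite -[LHS]comp1m -thom1 -ip thom_suml comp_suml; apply: eq_bigr => k _.
  rewrite -jq thom_sumr comp_suml; apply: eq_bigr => h _.
  by rewrite thomM compA.
rewrite ddual_sum; apply: eq_bigr => k _; rewrite ddual_sum; apply: eq_bigr => h _.
pose T := tensor_pair (twist_pair (l k)) (twist_pair (r h)).
rewrite (ddual_comp _ T) (ddual_tensor _ _ (DualPair a a') (DualPair b b')) aa' bb'.
congr (_ ∘ _); move: (_ ∘ f) => v; have [->|v0] := eqVneq v 0; first exact: ddual0.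
have N0 : fusion_coef i (l k) (r h) != 0%N by apply/fusion_coef_neq0; exists v.
rewrite /ddual /= (rdagger_scaled _ (scaled_nested (twist_ladjP (r h)) (twist_ladjP (l k)))
  (twist_ladjP i)).
have := epsP v; rewrite /ddual /= => ->; rewrite scalerA (mulrC (t (r h))) (t_twist N0).
by rewrite mulrAC -mulrA mulVf ?scale1r // mulf_neq0 // (eps_neq0 eps_sign).
Qed.

Lemma compat_one : compat (one_adj C) (one_adj C).
Proof.
move=> i f; have [->|f0] := eqVneq f 0; first exact: ddual0.
have [u [u' [u'u uu']]] := rep_unit_iso X.
have i0 : i = idx0 X.
  apply: (rep_hom_neq0 (f := u' ∘ f)); apply: contra_neq f0 => uf0.
  by rewrite -[f]comp1m -uu' -compA uf0 comp0r.
move: f f0; rewrite i0 => f _.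
apply: (ddual_balanced (P := twist_pair _) (Q := one_pair C)).
- exact: rep_simple.
- exact: fus_unit.
- apply: scal_inj; rewrite rtrace_one scal_id /rtrace thom1 compm1 /=.
  by rewrite (twist_ladjP _).2 compZl scalZ (padjP D (idx0 X)) twist_unit root_unit_sqr.
Qed.

Definition twist_map V V' (a : adj V V') : adj V' V := sval (cid (compat_exists a)).

Lemma twist_mapP V V' (a : adj V V') : compat a (twist_map a).
Proof. exact: svalP (cid _). Qed.

(** Both sides of each of the first three axioms are compatible with the same
    right dual. *)
Definition twist_evenHanded : evenHanded C.
Proof.
apply: (EvenHanded (eh_map := twist_map)).
- move=> V V' a; apply: (compat_uniq (twist_mapP _)).
  exact: compat_swap (twist_mapP a).
- move=> V V' W W' a b; apply: (compat_uniq (twist_mapP _)).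
  exact: compat_tensor (twist_mapP a) (twist_mapP b).
- exact: compat_uniq (twist_mapP _) compat_one.
- move=> V V' W W' a b f.
  have := compat_ddual f (twist_mapP a) (twist_mapP b); rewrite /ddual /= => E.
  by rewrite -[in RHS]E ldagger_rdagger.
Defined.

Lemma twist_evenHanded_rep i : scaled (t i) (padj D i) (twist_evenHanded _ _ (dadj D i)).
Proof.
rewrite (_ : twist_evenHanded _ _ _ = twist_ladj i); first exact: twist_ladjP.
by apply: compat_uniq; [apply: twist_mapP | apply: compat_rep].
Qed.

(** An even-handed structure is thus determined by its scalars. *)
Lemma evenHanded_compat (Psi : evenHanded C) :
    (forall i, scaled (t i) (padj D i) (Psi _ _ (dadj D i))) ->
  forall V V' (a : adj V V'), compat a (Psi _ _ a).
Proof.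
move=> PsiP V V' a i f.
have E : twist_ladj i = Psi _ _ (dadj D i).
  by apply: adj_ext; rewrite (twist_ladjP i).2 (PsiP i).2.
by rewrite /twist_pair E; apply: eh_ddual.
Qed.

(** Cyclicity of both traces reduces the equality to the identities of the X_i,
    where the traces are t_i d_i and t_i^-1 d_i. *)
Lemma twist_spherical : (forall i, is_sign (t i)) -> spherical twist_evenHanded.
Proof.
move=> t_sign V V' a f; pose P := eh_pair twist_evenHanded a.
change (rtrace P f = ltrace P f).
have [n [l [inj [prj [_ _ ip]]]]] := rep_decomp X V.
rewrite -[f]compm1 -ip comp_sumr rtrace_sum ltrace_sum; apply: eq_bigr => k _.
pose Q := eh_pair twist_evenHanded (dadj D (l k)).
have prjE : ddual P Q (prj k) = 1 *: prj k by rewrite scale1r eh_ddual.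
rewrite compA (rtrace_cyclic _ prjE) -[RHS]scale1r (ltrace_cyclic _ prjE) scale1r.
have [c ->] := simple_scalar (rep_simple (l k)) (prj k ∘ (f ∘ inj k)).
rewrite rtraceZ ltraceZ; congr (_ *: _); apply: scal_inj.
have [cE eE] := twist_evenHanded_rep (l k).
have := ltrace_rep hd D (l k); have := rtrace_rep D (l k).
rewrite /rtrace /ltrace !thom1 !compm1 /= cE eE compZl compZr !scalZ => -> ->.
by case: (t_sign (l k)) => ->; rewrite ?invrN invr1.
Qed.

End ToEvenHanded.

Lemma evenHanded_ext (K : fieldType) (C : monCat K) (Psi Phi : evenHanded C) :
  (forall V V' (a : adj V V'), Psi _ _ a = Phi _ _ a) -> Psi = Phi.
Proof.
case: Psi => f f1 f2 f3 f4; case: Phi => g g1 g2 g3 g4 /= fg.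
have E : f = g.
  by apply: functional_extensionality_dep => V; apply: functional_extensionality_dep => V';
     apply: functional_extensionality_dep => a.
by subst g; congr EvenHanded; apply: Prop_irrelevance.
Qed.

(** * The classification *)

Section Classification.
Variables (K : fieldType) (C : fusionCat K) (X : simpleReps C).
Variables (d : idx X -> K) (hd : root_choice d) (D : dualChoice d).
Implicit Types (Psi : evenHanded C) (i j k : idx X).

Lemma eh_scalars Psi : exists t : idx X -> K, (forall i, t i != 0) /\
  forall i V' (a : adj (X i) V') (b : adj V' (X i)),
    partner d a b -> scaled (t i) b (Psi _ _ a).
Proof.
have sc i := cid2 (eh_scalar D Psi i).
exists (fun i => s2val (sc i)); split=> i; first exact: s2valP (sc i).
by move=> V' a b; apply: (s2valP' (sc i)).
Qed.

Lemma evenHanded_sign Psi i j k :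
  (forall v : X i ~> X j ⊗ X k, involution_op D v = v) \/
  (forall v : X i ~> X j ⊗ X k, involution_op D v = - v).
Proof.
have [t [t0 tP]] := eh_scalars Psi.
have [all0|/existsNP[v v0]] := pselect (forall v : X i ~> X j ⊗ X k, v = 0).
  by left=> v; rewrite (all0 (involution_op D v)) (all0 v).
pose T (w : X i ~> X j ⊗ X k) :=
  scaled_ddual_rep (D := D) w (fun h => tP h _ _ _ (padjP D h)) t0.
have := ddual_sqr hd (introN eqP v0) (T v).
move/eqP; rewrite sqrf_eq1 => /orP s1; case: s1 => /eqP s1; [left|right] => w.
  by rewrite involution_opE T s1 scale1r.
by rewrite involution_opE T s1 scaleN1r.
Qed.

Section Signs.
Variable eps : idx X -> idx X -> idx X -> K.
Hypothesis eps_sign : forall i j k, is_sign (eps i j k).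
Hypothesis epsP : forall i j k (v : X i ~> X j ⊗ X k),
  involution_op D v = eps i j k *: v.

Lemma scalars_twist Psi (t : idx X -> K) : (forall i, t i != 0) ->
    (forall i, scaled (t i) (padj D i) (Psi _ _ (dadj D i))) ->
  forall i j k, fusion_coef i j k != 0%N -> t j * t k = eps i j k * t i.
Proof.
move=> t0 tP i j k /fusion_coef_neq0[v v0].
by rewrite (eps_uniq epsP v0 (scaled_ddual_rep v tP t0)) divfK.
Qed.

Lemma sign_sqr (x : K) : is_sign x -> x * x = 1.
Proof. by case=> ->; rewrite ?mulrNN mulr1. Qed.

Lemma twistedAut_ext (s t : twistedAut eps) : sval s = sval t -> s = t.
Proof.
case: s t => s sP [t tP] /= E; subst t.
by congr exist; apply: Prop_irrelevance.
Qed.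

Lemma evenHanded_bijection : exists F : evenHanded C -> twistedAut eps,
  bijective F /\
  forall Psi i (V' : C) (a : adj (X i) V') (b : adj V' (X i)),
    partner d a b -> scaled (sval (F Psi) i) b (Psi _ _ a).
Proof.
have total Psi : {t : twistedAut eps |
    forall i (V' : C) (a : adj (X i) V') (b : adj V' (X i)),
      partner d a b -> scaled (sval t i) b (Psi _ _ a)}.
  have [t [t0 tP]] := cid (eh_scalars Psi).
  have tw := scalars_twist t0 (fun i => tP i _ _ _ (padjP D i)).
  by exists (exist _ t (conj t0 tw)).
exists (fun Psi => sval (total Psi)); split; last by move=> Psi; apply: svalP (total Psi).
pose G (t : twistedAut eps) : evenHanded C :=
  twist_evenHanded hd eps_sign epsP (svalP t).1 (svalP t).2.
have GP (t : twistedAut eps) : forall i, scaled (sval t i) (padj D i) (G t _ _ (dadj D i)).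
  exact: twist_evenHanded_rep.
have FP Psi i : scaled (sval (sval (total Psi)) i) (padj D i) (Psi _ _ (dadj D i)).
  exact: (svalP (total Psi) i _ _ _ (padjP D i)).
exists G => [Psi|t].
  apply: evenHanded_ext => V V' a.
  set t := sval (total Psi).
  apply: (compat_uniq (t_neq0 := (svalP t).1) (a := a)).
    by apply: evenHanded_compat => i; apply: GP.
  by apply: evenHanded_compat => i; apply: FP.
have E : sval (sval (total (G t))) = sval t.
  apply: functional_extensionality_dep => i.
  have [_ e1] := FP (G t) i; have [_ e2] := GP t i.
  have : ev (padj D i) != 0.
    apply: contra_neq (ev_coev_neq0 (dadj D i) (padj D i) (rep_simple i)) => ->.
    by rewrite comp0l.
  move=> ev0; apply/eqP; rewrite -subr_eq0; apply: contraNT ev0 => nz.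
  by rewrite -(inj_eq (scalerI nz)) scaler0 scalerBl -e1 -e2 subrr.
exact: twistedAut_ext.
Qed.

Lemma eps_pivotal : d (idx0 X) = 1 -> pivotal_symbols eps.
Proof.
move=> d1; split=> [i j k _|i j k|i j k|i]; first exact: eps_sign.
- exact: (eps_rot hd epsP).
- exact: (eps_dual hd eps_sign epsP).
- by rewrite (eps_unit hd epsP).
Qed.

Lemma spherical_piv_trivial : d (idx0 X) = 1 ->
  (exists Psi : evenHanded C, spherical Psi) <-> piv_trivial eps.
Proof.
move=> d1; split=> [[Psi sph]|[f [f_sign f0 f_star fE]]].
  have [t [t0 tP']] := eh_scalars Psi.
  have tP i : scaled (t i) (padj D i) (Psi _ _ (dadj D i)) := tP' i _ _ _ (padjP D i).
  have tw := scalars_twist t0 tP.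
  have t_sqr i : t i * t i = 1.
    have := sph _ _ (dadj D i) (idm _); rewrite !thom1 !compm1 (tP i).1 (tP i).2.
    rewrite compZl compZr => /(congr1 (@scal _ _)); rewrite !scalZ.
    have := rtrace_rep D i; have := ltrace_rep hd D i.
    rewrite /rtrace /ltrace !thom1 !compm1 /= => -> -> /(mulIf (root_neq0 D i)) {1}->.
    by rewrite mulVf.
  have t_unit : t (idx0 X) = 1 by rewrite (twist_unit hd epsP t0 tw).
  exists t; split=> // [i|i|i j k N0].
  - by move/eqP: (t_sqr i); rewrite -expr2 sqrf_eq1 => /orP[]/eqP ->; [left|right].
  - apply: (mulfI (t0 i)); rewrite t_sqr (tw _ _ _ (hom_unit_coef hd D i)).
    by rewrite t_unit (eps_unit hd epsP) d1 mulr1.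
  - rewrite -(mulrA (t i)) (tw _ _ _ N0) mulrCA t_sqr mulr1.
    by rewrite sign_sqr.
have f_neq0 i : f i != 0 by case: (f_sign i) => ->; rewrite ?oppr_eq0 oner_neq0.
have f_twist i j k : fusion_coef i j k != 0%N -> f j * f k = eps i j k * f i.
  move=> N0; have fE1 : f i * f j * f k * eps i j k = 1 by rewrite -(fE _ _ _ N0).
  rewrite -[RHS]mul1r -fE1 -mulrA (mulrA (eps _ _ _)) sign_sqr // mul1r.
  by rewrite -(mulrA (f i)) [RHS]mulrC !mulrA sign_sqr // mul1r.
exists (twist_evenHanded hd eps_sign epsP f_neq0 f_twist).
exact: twist_spherical.
Qed.

End Signs.
End Classification.

Theorem theorem6p16 (R : realType) (C : fusionCat R[i]) (X : simpleReps C)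
    (d : idx X -> R[i]) (hd : root_choice d) (D : dualChoice d) :
  (~ (forall i j k : idx X,
        (forall v : X i ~> X j ⊗ X k, involution_op D v = v) \/
        (forall v : X i ~> X j ⊗ X k, involution_op D v = - v)) ->
   ~ inhabited (evenHanded C)) /\
  (forall eps : idx X -> idx X -> idx X -> R[i],
     (forall i j k, is_sign (eps i j k)) ->
     (forall i j k (v : X i ~> X j ⊗ X k),
        involution_op D v = eps i j k *: v) ->
     (exists F : evenHanded C -> twistedAut eps,
        bijective F /\
        forall (Psi : evenHanded C) (i : idx X) (V' : C)
            (a : adj (X i) V') (b : adj V' (X i)),
          partner d a b ->
          coev (Psi _ _ a) = (sval (F Psi) i)^-1 *: coev b /\
          ev (Psi _ _ a) = sval (F Psi) i *: ev b) /\
     (d (idx0 X) = 1 ->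
        pivotal_symbols eps /\
        ((exists Psi : evenHanded C, spherical Psi) <-> piv_trivial eps))).
Proof.
split=> [not_sign [Psi]|eps eps_sign epsP].
  by apply: not_sign => i j k; apply: (evenHanded_sign hd D Psi).
split; first exact: (evenHanded_bijection hd eps_sign epsP).
move=> d1; split; first exact: (eps_pivotal hd eps_sign epsP d1).
exact: (spherical_piv_trivial hd eps_sign epsP d1).
Qed.
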